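(* Let $n\ge1$, $\delta>0$ and $n<\beta<n+2$. Let $\mathbf f\in\mathcal H^{s_1}(\mathbf T^n)$ and $\mathbf g\in\mathcal H^{s_2}(\mathbf T^n)$ with $s_1,s_2\ge0$, and suppose that there exists a nonnegative integer $p$ such that $$s_1>n+p\,\frac{\beta-n}{2}\quad\text{and}\quad s_2>n+(p-1)\frac{\beta-n}{2}.$$ Let $$\mathbf u(x,t)=(\widehat{\mathbf f}_0+\widehat{\mathbf g}_0t)+\sum_{0\ne k\in\mathbb{Z}^n}\left(\cos(\sqrt{-M_k}\,t)\widehat{\mathbf f}_k+\sin(\sqrt{-M_k}\,t)(\sqrt{-M_k})^{-1}\widehat{\mathbf g}_k\right)e^{ik\cdot x}$$ for $x\in\mathbf T^n$, $t\ge0$. Then $\mathbf u(x,\cdot)\in C^p[0,\infty)$ (in the classical sense) for any $x\in\mathbf T^n$.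
   Context: Torus and spaces: $\mathbf T^n=\prod_{i=1}^n[0,2\pi]$ with periodic identification; a periodic vector distribution $\mathbf g$ is written $\mathbf g=\sum_{k\in\mathbb{Z}^n}\widehat{\mathbf g}_k e^{ik\cdot x}$ with Fourier coefficients $\widehat{\mathbf g}_k\in\mathbb{C}^n$. For $q\in\mathbb{R}$, $\mathcal H^q(\mathbf T^n)$ is the space of periodic vector distributions with $\|\mathbf g\|^2_{\mathcal H^q}=\sum_k(1+\|k\|^2)^q\|\widehat{\mathbf g}_k\|^2<\infty$. Multipliers: with ${}_pF_q(a_1,\dots,a_p;b_1,\dots,b_q;x)=\sum_{m\ge0}\frac{(a_1)_m\cdots(a_p)_m}{(b_1)_m\cdots(b_q)_m}\frac{x^m}{m!}$, where $(a)_m=a(a+1)\cdots(a+m-1)$, set for $\nu\in\mathbb{R}^n$ $$\lambda_1(\nu)=-\|\nu\|^2\Big(3\mu\,{}_3F_4\big(1,\tfrac52,\tfrac{n+2-\beta}{2};2,\tfrac32,\tfrac{n+4}{2},\tfrac{n+4-\beta}{2};-\tfrac14\|\nu\|^2\delta^2\big)+(\lambda^*-\mu)\,{}_1F_2\big(\tfrac{n+2-\beta}{2};\tfrac{n+2}{2},\tfrac{n+4-\beta}{2};-\tfrac14\|\nu\|^2\delta^2\big)^2\Big),$$ $$\lambda_2(\nu)=-\mu\|\nu\|^2\,{}_2F_3\big(1,\tfrac{n+2-\beta}{2};2,\tfrac{n+4}{2},\tfrac{n+4-\beta}{2};-\tfrac14\|\nu\|^2\delta^2\big).$$ For $k\in\mathbb{Z}^n\setminus\{0\}$,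 $M_k$ is the real symmetric $n\times n$ matrix with $M_kk=\lambda_1(k)k$ and $M_kw=\lambda_2(k)w$ for $w\perp k$ (the Fourier multiplier of the linear state-based peridynamic operator). $\sqrt{-M_k}$, $\cos(\sqrt{-M_k}t)$, $\sin(\sqrt{-M_k}t)$ are defined by functional calculus: same eigenvectors, with eigenvalues $\sqrt{-\lambda_i(k)}$, $\cos(\sqrt{-\lambda_i(k)}t)$, $\sin(\sqrt{-\lambda_i(k)}t)$. Standing assumption: the Lamé parameters satisfy $\mu>0$ and $\lambda^*\in\mathbb{R}$ is such that $\lambda_1(\nu)<0$ for all $\nu\ne0$ (and $\lambda_2(\nu)<0$ for all $\nu\neq0$). *)

(* Defs.v *)
(* MathComp / MathComp-Analysis, over an abstract R : realType; C = R[i]. *)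
From HB Require Import structures.
From mathcomp Require Import all_boot all_order all_algebra finmap.
From mathcomp Require Import all_classical all_reals all_analysis.
From mathcomp.real_closed Require Import complex.

Set Implicit Arguments.
Unset Strict Implicit.
Unset Printing Implicit Defensive.
Import Order.TTheory GRing.Theory Num.Theory.
Import numFieldNormedType.Exports.

Local Open Scope classical_set_scope.
Local Open Scope ring_scope.
Local Open Scope complex_scope.

Section Hypergeometric.
Variable R : realType.

Definition poch (a : R) (m : nat) : R := \prod_(j < m) (a + j%:R).

(* limn is total; everywhere below, size a <= size b and no entry of b is in
   {0, -1, -2, ...}, so that the series converges for every x. *)
Definition hypergeo (a b : seq R) (x : R) : R :=
  limn (series (fun m : nat =>
    (\prod_(c <- a) poch c m) / (\prod_(c <- b) poch c m)
      * (x ^+ m / m`!%:R))).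

End Hypergeometric.

Section Vectors.
Variables (R : realType) (n : nat).
Implicit Types v w : 'cV[R]_n.

Definition dotv v w : R := \sum_(i < n) v i 0 * w i 0.

Definition sqnorm v : R := \sum_(i < n) v i 0 ^+ 2.

Definition csqnorm (z : 'cV[R[i]]_n) : R :=
  \sum_(i < n) Normc.normc (z i 0) ^+ 2.

Definition zvec (k : 'cV[int]_n) : 'cV[R]_n := map_mx intr k.

(* Points of the torus are given by representatives in the closed cell. *)
Definition torus : set 'cV[R]_n :=
  [set x | forall i, 0 <= x i 0 <= 2 * pi].

Definition expi (th : R) : R[i] := cos th +i* sin th.

Definition cmx (A : 'M[R]_n) : 'M[R[i]]_n := map_mx (real_complex R) A.

(* For v != 0, the symmetric matrix with eigenvalue a on the line of v and b
   on the orthogonal complement of v; see eigmxP and eigmx_uniq. *)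
Definition eigmx (a b : R) v : 'M[R]_n :=
  b%:M + ((a - b) / sqnorm v) *: (v *m v^T).

Lemma dotvv v : dotv v v = sqnorm v.
Proof. by apply: eq_bigr => i _; rewrite expr2. Qed.

Lemma dotvDZ v (c d : R) w1 w2 :
  dotv v (c *: w1 + d *: w2) = c * dotv v w1 + d * dotv v w2.
Proof.
rewrite /dotv !mulr_sumr -big_split; apply: eq_bigr => i _.
by rewrite !mxE mulrDr !(mulrCA (v i 0)).
Qed.

Lemma sqnorm_eq0 v : (sqnorm v == 0) = (v == 0).
Proof.
apply/eqP/eqP => [v0|->]; last first.
  by rewrite /sqnorm big1// => i _; rewrite mxE expr0n.
apply/matrixP => i j; rewrite ord1 mxE.
have /psumr_eq0P : forall i, true -> 0 <= v i 0 ^+ 2.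
  by move=> *; exact: sqr_ge0.
by move=> /(_ v0 i isT)/eqP; rewrite sqrf_eq0 => /eqP.
Qed.

Lemma eigmxE a b v w :
  eigmx a b v *m w = b *: w + ((a - b) / sqnorm v * dotv v w) *: v.
Proof.
rewrite mulmxDl mul_scalar_mx -scalemxAl -mulmxA.
have -> : v^T *m w = (dotv v w)%:M.
  apply/matrixP => i j; rewrite !ord1 !mxE eqxx mulr1n.
  by apply: eq_bigr => l _; rewrite mxE.
by rewrite mul_mx_scalar scalerA.
Qed.

Lemma eigmxP a b v : v != 0 ->
  [/\ (eigmx a b v)^T = eigmx a b v,
      eigmx a b v *m v = a *: v
    & forall w, dotv v w = 0 -> eigmx a b v *m w = b *: w].
Proof.
move=> v0; split.
- by rewrite /eigmx linearD linearZ /= tr_scalar_mx trmx_mul trmxK.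
- by rewrite eigmxE dotvv divfK ?sqnorm_eq0// -scalerDl addrC subrK.
- by move=> w w0; rewrite eigmxE w0 mulr0 scale0r addr0.
Qed.

Lemma orth_decomp v w : v != 0 ->
  exists2 w', dotv v w' = 0 & w = (dotv v w / sqnorm v) *: v + w'.
Proof.
move=> v0; exists (1 *: w + - (dotv v w / sqnorm v) *: v).
  by rewrite dotvDZ dotvv mulNr divfK ?sqnorm_eq0// mul1r subrr.
by rewrite scale1r scaleNr addrC subrK.
Qed.

Lemma eigmx_uniq a b v (A : 'M[R]_n) : v != 0 ->
  A *m v = a *: v -> (forall w, dotv v w = 0 -> A *m w = b *: w) ->
  A = eigmx a b v.
Proof.
move=> v0 Av Aw; have [_ Ev Ew] := eigmxP a b v0.
suff AE w : A *m w = eigmx a b v *m w.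
  apply/matrixP => i j.
  by have /matrixP/(_ i 0) := AE (delta_mx j 0); rewrite -!colE !mxE.
have [w' vw' ->] := orth_decomp w v0.
by rewrite !mulmxDr -!scalemxAr Av Ev Aw// Ew.
Qed.

End Vectors.

Section Multipliers.
Variables (R : realType) (n : nat) (delta beta mu lams : R).

Let harg (nu : 'cV[R]_n) : R := - (4^-1 * sqnorm nu * delta ^+ 2).

Definition lambda1 (nu : 'cV[R]_n) : R :=
  - sqnorm nu *
    (3 * mu *
       hypergeo [:: 1; 5 / 2; (n%:R + 2 - beta) / 2]
                [:: 2; 3 / 2; (n%:R + 4) / 2; (n%:R + 4 - beta) / 2] (harg nu)
     + (lams - mu) *
       hypergeo [:: (n%:R + 2 - beta) / 2]
                [:: (n%:R + 2) / 2; (n%:R + 4 - beta) / 2] (harg nu) ^+ 2).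

Definition lambda2 (nu : 'cV[R]_n) : R :=
  - mu * sqnorm nu *
    hypergeo [:: 1; (n%:R + 2 - beta) / 2]
             [:: 2; (n%:R + 4) / 2; (n%:R + 4 - beta) / 2] (harg nu).

Definition multmx (k : 'cV[int]_n) : 'M[R]_n :=
  eigmx (lambda1 (zvec R k)) (lambda2 (zvec R k)) (zvec R k).

(* phi(M_k) for M_k = multmx k and k != 0; see multfunP. *)
Definition multfun (phi : R -> R) (k : 'cV[int]_n) : 'M[R]_n :=
  eigmx (phi (lambda1 (zvec R k))) (phi (lambda2 (zvec R k))) (zvec R k).

Lemma zvec_eq0 (k : 'cV[int]_n) : (zvec R k == 0) = (k == 0).
Proof.
apply/eqP/eqP => [k0|->]; last by rewrite /zvec map_mx0.
apply/matrixP => i j; move/matrixP/(_ i j)/eqP: k0.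
by rewrite !mxE intr_eq0 => /eqP.
Qed.

Lemma multfunP phi k a (w : 'cV[R]_n) : k != 0 ->
  multmx k *m w = a *: w -> multfun phi k *m w = phi a *: w.
Proof.
rewrite -zvec_eq0 /multmx /multfun; move: (zvec R k) => v v0.
set l1 := lambda1 v; set l2 := lambda2 v.
have [w' vw'] := orth_decomp w v0; set c := _ / _ => ->.
have [_ Ev Ew] := eigmxP l1 l2 v0.
have [_ Fv Fw] := eigmxP (phi l1) (phi l2) v0.
rewrite !mulmxDr -!scalemxAr Ev Ew// Fv Fw// !scalerDr !scalerA => Mw.
have /(congr1 (dotv v)) := Mw.
rewrite !dotvDZ dotvv vw' !mulr0 !addr0 => /mulIf.
rewrite sqnorm_eq0 => /(_ v0) la; move: Mw; rewrite la => /addrI/eqP.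
rewrite -subr_eq0 -scalerBl scaler_eq0 subr_eq0 => /orP w'0.
congr (_ + _).
  have [->|c0] := eqVneq c 0; first by rewrite mul0r mulr0.
  by move: la; rewrite mulrC => /(mulIf c0) ->; rewrite mulrC.
by case: w'0 => /eqP ->; rewrite ?scaler0.
Qed.

Definition sqrtNM : 'cV[int]_n -> 'M[R]_n :=
  multfun (fun l => Num.sqrt (- l)).

Definition cos_sqrtNM (t : R) : 'cV[int]_n -> 'M[R]_n :=
  multfun (fun l => cos (Num.sqrt (- l) * t)).

Definition sin_sqrtNM (t : R) : 'cV[int]_n -> 'M[R]_n :=
  multfun (fun l => sin (Num.sqrt (- l) * t)).

End Multipliers.

(* A periodic vector distribution is represented by the family of its Fourier
   coefficients; finiteness of the norm below entails the polynomial growth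
   that makes such a family the coefficients of a distribution. *)
Definition Hspace (R : realType) (n : nat) (q : R) :
    set ('cV[int]_n -> 'cV[R[i]]_n) :=
  [set g | (\esum_(k in [set: 'cV[int]_n])
     ((1 + sqnorm (zvec R k)) `^ q * csqnorm (g k))%:E < +oo)%E].

Section UnorderedSum.
Variable I : choiceType.

(* The filter of finite subsets of I directed by inclusion. *)
Definition finsets : set_system {fset I} :=
  filter_from [set: {fset I}] (fun A => [set B | fsubset A B]).

#[global] Instance finsets_filter : ProperFilter finsets.
Proof.
apply: filter_from_proper; last by move=> A _; exists A => /=.
apply: filter_from_filter; first by exists fset0.
move=> A B _ _; exists (fsetU A B) => // D /=.
by rewrite fsubUset => /andP.
Qed.

Variables (K : numFieldType) (V : normedModType K) (D : set I) (F : I -> V).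

Definition partial_sum (A : {fset I}) : V := \sum_(i <- A | i \in D) F i.

(* Unconditional convergence of the series of F over D, and its sum. *)
Definition usummable : Prop := cvg (partial_sum @ finsets).

Definition usum : V := lim (partial_sum @ finsets).

End UnorderedSum.

Section RegularityOnHalfLine.
Variables (R : realType) (V : normedModType R[i]).
Implicit Types h : R -> V.

(* h' is the derivative of h on [0, oo[, one-sided at 0. *)
Definition is_deriv_halfline h h' : Prop :=
  forall t : R, 0 <= t ->
    (s - t)^-1%:C *: (h s - h t) @[s --> within [set s : R | 0 <= s] t^'] --> h' t.

Fixpoint Cp_halfline (p : nat) h : Prop :=
  if p is p'.+1 then
    exists2 h', is_deriv_halfline h h' & Cp_halfline p' h'
  else {within [set t : R | 0 <= t], continuous h}.

End RegularityOnHalfLine.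

Section Solution.
Variables (R : realType) (n : nat) (delta beta mu lams : R).
Variables (f g : 'cV[int]_n -> 'cV[R[i]]_n).

Definition solution_term (x : 'cV[R]_n) (t : R) (k : 'cV[int]_n) :
    'cV[R[i]]_n :=
  expi (dotv (zvec R k) x) *:
    (cmx (cos_sqrtNM delta beta mu lams t k) *m f k
     + cmx (sin_sqrtNM delta beta mu lams t k
            *m invmx (sqrtNM delta beta mu lams k)) *m g k).

Definition solution (x : 'cV[R]_n) (t : R) : 'cV[R[i]]_n :=
  (f 0 + t%:C *: g 0) + usum [set k | k != 0] (solution_term x t).

End Solution.

(* Main.v *)
Require Import Defs.
From mathcomp Require Import all_boot all_order all_algebra finmap ring lra.
From mathcomp Require Import all_classical all_reals all_analysis.
From mathcomp.real_closed Require Import complex.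
Import Order.TTheory GRing.Theory Num.Theory.
Import numFieldNormedType.Exports.
Set Implicit Arguments.
Unset Strict Implicit.
Unset Printing Implicit Defensive.
Local Open Scope classical_set_scope.
Local Open Scope ring_scope.

(** Let [a = (n + 2 - beta) / 2], which lies in [(0, 1)], and
    [eta = (beta - n) / 2 = 1 - a]. The theorem rests on two facts: both
    multipliers [- lambda_i(k)] have exact order [(1 + |k| ^ 2) ^ eta], and a
    trigonometric series may be differentiated as many times as its amplitudes
    remain absolutely summable after multiplication by the frequencies
    [sqrt (- lambda_i(k))].

    Order of the multipliers. Put [b = n / 2]. The series 1F2 and 2F3 are the
    averages [a \int_0^1 s ^ (a - 1) h(s x) ds] of [h = phi (b + 1)] and of
    [h = psi (b + 1) = (b + 1) (1 - phi (b + 1)) / x], where [phi c] is the Bessel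
    function 0F1(; c; - x), and the series 3F4 is a positive combination of 2F3
    and [psi (b + 1)]. An average [A] of [h] satisfies
    [(x ^ a A)' = a x ^ (a - 1) h], so that its order follows from bounds on [h],
    and these come from an energy that decreases along the Bessel equation
    ([phi_energy]): [|phi c| <= 1] and [phi (b + 1) = O(x ^ (- 1 / 2))]. Hence
    [0 <= psi (b + 1) = O(1 / x)], which makes 2F3 and 3F4 of exact order
    [x ^ (- a)] ([damped_psi_bounds]), whereas the square of 1F2 is of smaller
    order ([damped_phi_bound]). Far from the origin the first multiplier thus has
    the order of its 3F4 part; on a bounded range it is bounded below by
    continuity and by the assumption on its sign ([longitudinal_symbol_bounds]).

    Summation. In the spectral decomposition of [M_k] the [k]-th term of the
    solution is a sum of four oscillations, with amplitudes bounded, up to a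
    constant, by those of [f k], or by those of [g k] divided by the frequency.
    Young's inequality bounds such an amplitude, times the [p]-th power of the
    frequency, by the [k]-th term of the Sobolev norm plus a multiple of [(1 +
    |k| ^ 2) ^ (- n)] ([Hspace_weighted]); the exponent [- n] is what the
    conditions on [s1] and [s2] leave. Since [(1 + |k| ^ 2) ^ n] dominates the
    product of the [1 + k_i ^ 2], these terms are summable over the lattice
    ([lattice_sum_bounded]).

    Calculus. Sums over finite subsets are handled on real coordinates
    ([coord_usum]); dominated convergence for unordered sums ([dominated_usum])
    gives the continuity and the termwise derivative of a trigonometric series,
    and [Cp_trig_series] iterates the latter. *)

(** * Entire power series *)

Section EntireSeries.
Variable R : realType.
Implicit Types (c d : nat -> R) (x : R).

(** Coefficients dominated by those of an exponential series: such series
    converge everywhere, and the condition survives differentiation. *)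
Definition exp_bounded c :=
  exists K B : R, 0 <= B /\ forall m, `|c m| <= K * (B ^+ m / m`!%:R).

Definition psum c x : R := limn (pseries c x).

Lemma exp_bounded_cvg c x : exp_bounded c -> cvgn (pseries c x).
Proof.
move=> [K [B [B0 cB]]]; apply: normed_cvg.
have K0 : 0 <= K.
  by have := le_trans (normr_ge0 _) (cB 0%N); rewrite expr0 fact0 divr1 mulr1.
apply: (@series_le_cvg _ _ (fun m => K * exp_coeff (B * `|x|) m)) => //.
- by move=> m; exact: normr_ge0.
- by move=> m; rewrite mulr_ge0// exp_coeff_ge0// mulr_ge0.
- move=> m; rewrite /exp_coeff /= normrM normrX exprMn.
  rewrite (_ : K * _ = K * (B ^+ m / m`!%:R) * `|x| ^+ m); last by ring.
  by rewrite ler_wpM2r// exprn_ge0.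
- by apply: is_cvg_seriesZ; exact: is_cvg_series_exp_coeff.
Qed.

Lemma psum_cvg c x : exp_bounded c -> pseries c x @ \oo --> psum c x.
Proof. exact: exp_bounded_cvg. Qed.

Lemma exp_bounded_diffs c : exp_bounded c -> exp_bounded (pseries_diffs c).
Proof.
move=> [K [B [B0 cB]]]; exists (K * B), B; split=> // m.
rewrite /pseries_diffs normrM normr_nat.
apply: le_trans (ler_wpM2l (ler0n _ _) (cB m.+1)) _.
rewrite factS natrM exprS le_eqVlt; apply/orP; left; apply/eqP.
by field; rewrite pnatr_eq0 -lt0n fact_gt0 /= -[1]/(1%:R) -natrD pnatr_eq0.
Qed.

Lemma exp_bounded_le c d :
  exp_bounded c -> (forall m, `|d m| <= `|c m|) -> exp_bounded d.
Proof.
move=> [K [B [B0 cB]]] dc; exists K, B; split=> // m.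
exact: le_trans (dc m) (cB m).
Qed.

Lemma psum_derive c x : exp_bounded c ->
  is_derive x 1 (psum c) (psum (pseries_diffs c) x).
Proof.
move=> ec; have ed := exp_bounded_diffs ec.
apply: (@pseries_snd_diffs _ _ (`|x| + 1)); do ?exact: exp_bounded_cvg.
- exact/exp_bounded_cvg/exp_bounded_diffs.
- by rewrite [ltRHS]ger0_norm ?addr_ge0// ltrDl.
Qed.

Lemma psum_lin (k l : R) c d x : exp_bounded c -> exp_bounded d ->
  psum (fun m => k * c m + l * d m) x = k * psum c x + l * psum d x.
Proof.
move=> /(psum_cvg (x:=x)) cc /(psum_cvg (x:=x)) dc.
apply: cvg_lim => //.
have -> : pseries (fun m => k * c m + l * d m) x
    = (fun m => k * pseries c x m + l * pseries d x m).
  apply/funext => m; rewrite /pseries /series /= !mulr_sumr -big_split /=.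
  by apply: eq_bigr => i _; rewrite mulrDl !mulrA.
by apply: cvgD; apply: cvgMr.
Qed.

(** Peeling off the constant term yields the action of the Euler operator, the
    value at [0] and the link between [phi] and [psi]. *)
Lemma psum_shift c x : exp_bounded (fun m => c m.+1) ->
  psum c x = c 0%N + x * psum (fun m => c m.+1) x.
Proof.
move=> /(psum_cvg (x:=x)) cc; apply: cvg_lim => //.
rewrite -cvg_shiftS /=.
have -> : (fun m => pseries c x m.+1)
    = (fun m => c 0%N + x * pseries (fun m => c m.+1) x m).
  apply/funext => m; rewrite /pseries /series /= big_nat_recl//= expr0 mulr1.
  congr (_ + _); rewrite mulr_sumr; apply: eq_bigr => i _.
  by rewrite exprS mulrCA.
by apply: cvgD; [exact: cvg_cst | apply: cvgMr].
Qed.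

Lemma psum_theta c x : exp_bounded c ->
  psum (fun m => m%:R * c m) x = x * psum (pseries_diffs c) x.
Proof.
by move=> /exp_bounded_diffs ec; rewrite psum_shift// mul0r add0r.
Qed.

Lemma psum0 c : exp_bounded c -> psum c 0 = c 0%N.
Proof.
move=> ec; rewrite psum_shift ?mul0r ?addr0//.
apply: exp_bounded_le (exp_bounded_diffs ec) _ => m.
by rewrite /pseries_diffs normrM normr_nat ler_peMl// ler1n.
Qed.

End EntireSeries.

(** * Derivatives and monotonicity *)

Section RealDerivatives.
Variable R : realType.
Implicit Types (u v : R -> R) (x : R).

Lemma is_derive_mul x u v (du dv : R) : is_derive x 1 u du ->
  is_derive x 1 v dv -> is_derive x 1 (fun y => u y * v y) (du * v x + u x * dv).
Proof.
move=> hu hv; have := is_deriveM hu hv.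
by move/is_derive_eq; apply; rewrite addrC /GRing.scale /= [v x * _]mulrC.
Qed.

Lemma is_derive_add x u v (du dv : R) : is_derive x 1 u du ->
  is_derive x 1 v dv -> is_derive x 1 (fun y => u y + v y) (du + dv).
Proof. by move=> hu hv; exact: is_deriveD. Qed.

Lemma is_derive_scal x u (k du : R) : is_derive x 1 u du ->
  is_derive x 1 (fun y => k * u y) (k * du).
Proof. by move=> hu; have := is_deriveZ k hu. Qed.

Lemma is_derive_id1 x : is_derive x 1 (fun y : R => y) (1 : R).
Proof. exact: is_derive_id. Qed.

Lemma is_derive_cts u du x : is_derive x 1 u du -> {for x, continuous u}.
Proof. by move=> [/derivable1_diffP /differentiable_continuous]. Qed.

(** Every growth estimate below compares a function with its value at the left
    end of the range, through the sign of its derivative. *)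
Lemma le_of_derive_le0 (u du : R -> R) (x0 x : R) : x0 <= x ->
  (forall y, x0 <= y -> is_derive y 1 u (du y)) ->
  (forall y, x0 <= y -> du y <= 0) -> u x <= u x0.
Proof.
move=> x0x hu du0.
have [||c] := @MVT_segment _ u du x0 x x0x.
- by move=> y; rewrite in_itv/= => /andP[/ltW ? _]; exact: hu.
- apply: continuous_in_subspaceT => y; rewrite inE/= in_itv/= => /andP[? _].
  by apply: (@is_derive_cts _ (du y)); exact: hu.
rewrite in_itv/= => /andP[x0c _] uE.
by rewrite -subr_le0 uE mulr_le0_ge0 ?subr_ge0//; exact: du0.
Qed.

End RealDerivatives.

(** * Bessel functions *)

Section BesselSeries.
Variable R : realType.
Implicit Types (a c x : R) (m : nat).

Lemma factR_neq0 m : m`!%:R != 0 :> R.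
Proof. by rewrite pnatr_eq0 -lt0n fact_gt0. Qed.

Lemma poch0 c : poch c 0 = 1.
Proof. by rewrite /poch big_ord0. Qed.

Lemma pochS c m : poch c m.+1 = poch c m * (c + m%:R).
Proof. by rewrite /poch big_ord_recr. Qed.

Lemma pochSl c m : poch c m.+1 = c * poch (c + 1) m.
Proof.
rewrite /poch big_ord_recl addr0; congr (_ * _).
by apply: eq_bigr => i _; rewrite -addrA nat1r.
Qed.

Lemma poch_gt0 c m : 0 < c -> 0 < poch c m.
Proof. by move=> c0; apply: prodr_gt0 => i _; rewrite ltr_wpDr. Qed.

Lemma poch_ge c m : 2^-1 <= c -> 2^-1 ^+ m <= poch c m.
Proof.
move=> hc; elim: m => [|m IH]; first by rewrite poch0 expr0.
by rewrite exprSr pochS ler_pM ?exprn_ge0 ?invr_ge0 ?ler_wpDr.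
Qed.

(** [phi c x] is the hypergeometric function 0F1(; c; - x), that is
    [Gamma(c) x ^ ((1 - c) / 2) J_(c - 1)(2 sqrt x)] with [J] the Bessel
    function of the first kind. *)
Definition phi_coef c m : R := (-1) ^+ m / (poch c m * m`!%:R).

Definition phi c : R -> R := psum (phi_coef c).

Lemma phi_coef_exp_bounded c : 2^-1 <= c -> exp_bounded (phi_coef c).
Proof.
move=> hc; exists 1, 2; split=> // m.
have c0 : 0 < c by rewrite (lt_le_trans _ hc).
rewrite mul1r /phi_coef normrM normrX normrN1 expr1n mul1r invfM normrM.
rewrite !gtr0_norm ?invr_gt0 ?poch_gt0 ?ltr0n ?fact_gt0//.
rewrite ler_wpM2r ?invr_ge0// -[leRHS]invrK lef_pV2 ?posrE ?poch_gt0//.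
by rewrite -exprVn poch_ge.
Qed.

Lemma phi0 c : 2^-1 <= c -> phi c 0 = 1.
Proof.
move=> hc; rewrite /phi psum0; last exact: phi_coef_exp_bounded.
by rewrite /phi_coef poch0 fact0 !expr0 mulr1 divr1.
Qed.

Lemma phi_coefS c m : 0 < c ->
  pseries_diffs (phi_coef c) m = - c^-1 * phi_coef (c + 1) m.
Proof.
move=> c0; rewrite /pseries_diffs /phi_coef pochSl factS natrM exprS.
have p0 : poch (c + 1) m != 0 by rewrite gt_eqF// poch_gt0// addr_gt0.
by field; rewrite factR_neq0 p0 gt_eqF//= nat1r pnatr_eq0.
Qed.

Lemma phi_derive c x : 2^-1 <= c ->
  is_derive x 1 (phi c) (- c^-1 * phi (c + 1) x).
Proof.
move=> hc; have c0 : 0 < c by rewrite (lt_le_trans _ hc).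
have e1 : exp_bounded (phi_coef (c + 1)).
  by apply: phi_coef_exp_bounded; rewrite (le_trans hc)// lerDl.
have := psum_derive x (phi_coef_exp_bounded hc); move/is_derive_eq; apply.
rewrite /phi -[RHS]addr0 -[X in _ + X](mul0r (psum (phi_coef (c + 1)) x)).
rewrite -psum_lin//; congr psum; apply/funext => m.
by rewrite phi_coefS// mul0r addr0.
Qed.

(** Together with [(phi c)' = - phi (c + 1) / c], this contiguity relation is the
    Bessel equation written as a first-order system. *)
Lemma phi_contiguous c x : 2^-1 <= c ->
  x * psum (pseries_diffs (phi_coef (c + 1))) x = c * (phi c x - phi (c + 1) x).
Proof.
move=> hc; have c0 : 0 < c by rewrite (lt_le_trans _ hc).
have e1 : exp_bounded (phi_coef (c + 1)).
  by apply: phi_coef_exp_bounded; rewrite (le_trans hc)// lerDl.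
rewrite -psum_theta// mulrBr -mulNr -psum_lin//; last exact: phi_coef_exp_bounded.
congr psum; apply/funext => m; rewrite /phi_coef.
have cm0 : c + m%:R != 0 by rewrite gt_eqF// ltr_wpDr.
have -> : poch c m = c * poch (c + 1) m / (c + m%:R).
  by rewrite -pochSl pochS mulfK.
have p0 : poch (c + 1) m != 0 by rewrite gt_eqF// poch_gt0// addr_gt0.
by field; rewrite factR_neq0 p0 cm0 gt_eqF.
Qed.

(** The left-hand side is the energy [phi c ^ 2 + x (phi c)' ^ 2]. By the Bessel
    equation its derivative is [(1 - 2 c) (phi c)' ^ 2], so that it decreases
    from its value [1] at the origin. *)
Lemma phi_energy c x : 2^-1 <= c -> 0 <= x ->
  phi c x ^+ 2 + x * (c^-1 * phi (c + 1) x) ^+ 2 <= 1.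
Proof.
move=> hc x0; have c0 : 0 < c by rewrite (lt_le_trans _ hc).
have hc1 : 2^-1 <= c + 1 by rewrite (le_trans hc)// lerDl.
pose E y := phi c y * phi c y + c^-2 * (y * (phi (c + 1) y * phi (c + 1) y)).
pose dE y := phi (c + 1) y ^+ 2 * (c^-1 * (c^-1 - 2)).
have -> : phi c x ^+ 2 + x * (c^-1 * phi (c + 1) x) ^+ 2 = E x.
  by rewrite /E; field; rewrite gt_eqF.
have -> : 1 = E 0 by rewrite /E phi0// mul0r mulr0 addr0 mulr1.
apply: (@le_of_derive_le0 _ E dE) => // y y0; last first.
  rewrite /dE mulr_ge0_le0 ?sqr_ge0// mulr_ge0_le0 ?invr_ge0 ?(ltW c0)//.
  by rewrite subr_le0 -[leRHS]invrK lef_pV2 ?posrE ?invr_gt0.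
have dc := phi_derive y hc.
have d1 := psum_derive y (phi_coef_exp_bounded hc1).
have := is_derive_add (is_derive_mul dc dc) (is_derive_scal (c ^- 2)
  (is_derive_mul (is_derive_id1 y) (is_derive_mul d1 d1))).
move/is_derive_eq; apply.
have := phi_contiguous y hc; set D := psum (pseries_diffs _) _ => yD.
rewrite -/(phi (c + 1) y) /dE.
set p := phi c y in yD *; set q := phi (c + 1) y in yD *.
rewrite (_ : _ * (1 * _ + _) = (c ^+ 2)^-1 * (q ^+ 2 + 2 * q * (y * D))); last by ring.
by rewrite yD; field; rewrite gt_eqF.
Qed.

Lemma phi_le1 c x : 2^-1 <= c -> 0 <= x -> `|phi c x| <= 1.
Proof.
move=> hc x0; rewrite -ler_sqr ?nnegrE// -normrX.
rewrite expr1n ger0_norm ?sqr_ge0//.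
by apply: le_trans (phi_energy hc x0); rewrite lerDl mulr_ge0 ?sqr_ge0.
Qed.

(** The kinetic part of the energy of [phi c] bounds [phi (c + 1)], which is
    [(phi c)'] up to a constant factor. *)
Lemma phi_decay c x : 2^-1 <= c -> 0 < x ->
  `|phi (c + 1) x| <= c / Num.sqrt x.
Proof.
move=> hc x0; have c0 : 0 < c by rewrite (lt_le_trans _ hc).
have [x0' c0'] := (ltW x0, ltW c0).
rewrite ler_pdivlMr ?sqrtr_gt0// -ler_sqr ?nnegrE ?mulr_ge0 ?sqrtr_ge0//.
rewrite exprMn -normrX sqr_sqrtr// ger0_norm ?sqr_ge0//.
have := phi_energy hc (ltW x0); rewrite exprMn exprVn => h.
have {}h : x * ((c ^+ 2)^-1 * phi (c + 1) x ^+ 2) <= 1.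
  by apply: le_trans h; rewrite lerDr sqr_ge0.
rewrite mulrCA mulrC ler_pdivrMr ?exprn_gt0// mul1r in h.
by rewrite mulrC.
Qed.

End BesselSeries.

(** * Averaged series *)

Section DampedSeries.
Variables (R : realType) (a : R).
Hypothesis a0 : 0 < a.
Implicit Types (d : nat -> R) (x : R) (m : nat).

Definition damp d m : R := a / (a + m%:R) * d m.

Let am_gt0 m : 0 < a + m%:R. Proof. by rewrite ltr_wpDr. Qed.

Let am_ge0 m : 0 <= a / (a + m%:R). Proof. by rewrite divr_ge0// ltW. Qed.

Lemma damp_exp_bounded d : exp_bounded d -> exp_bounded (damp d).
Proof.
move=> ed; apply: exp_bounded_le ed _ => m.
rewrite /damp normrM ger0_norm//.
by rewrite ler_piMl// ler_pdivrMr// mul1r lerDl.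
Qed.

(** Damping the coefficients by [a / (a + m)] is the averaging operator
    [d |-> a \int_0^1 s ^ (a - 1) d(s x) ds]; this is the differential form of
    that fact. *)
Lemma damp_derive d x : exp_bounded d -> 0 < x ->
  is_derive x 1 (fun y => y `^ a * psum (damp d) y) (a * x `^ (a - 1) * psum d x).
Proof.
move=> ed x0; have ef := damp_exp_bounded ed.
have := is_derive_mul (is_derive1_powR a x0) (psum_derive x ef).
move/is_derive_eq; apply.
have -> : a * x `^ (a - 1) * psum d x = x `^ (a - 1) * (a * psum d x).
  by rewrite mulrCA mulrA.
have -> : a * psum d x = a * psum (damp d) x + x * psum (pseries_diffs (damp d)) x.
  rewrite -psum_theta// -[X in _ = _ + X]mul1r -[X in X = _]addr0.
  have em : exp_bounded (fun m => m%:R * damp d m).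
    have [K [B [B0 dB]]] := ed; exists (a * K), B; split=> // m.
    rewrite /damp normrM (normrM (a / _)) normr_nat (ger0_norm (am_ge0 m)).
    rewrite mulrA -[leRHS]mulrA; apply: ler_pM => //.
      by rewrite mulr_ge0.
    by rewrite mulrCA ler_piMr ?(ltW a0)// ler_pdivrMr// mul1r lerDr ltW.
  rewrite -psum_lin// -[X in _ + X](mul0r (psum d x)) -psum_lin//.
  congr psum; apply/funext => m; rewrite /damp.
  by field; rewrite gt_eqF.
by rewrite -(mulr_powRB1 (ltW x0) a0); ring.
Qed.

(** A bound [K y ^ (s - a)] on a function bounds its average by integration of
    [a K y ^ (s - 1)]. *)
Lemma damp_growth d (x0 K s : R) : exp_bounded d -> 0 < x0 -> s != 0 ->
  (forall y, x0 <= y -> `|psum d y| <= K * y `^ (s - a)) ->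
  forall x, x0 <= x -> `|x `^ a * psum (damp d) x| <=
     `|x0 `^ a * psum (damp d) x0| + a * K / s * (x `^ s - x0 `^ s).
Proof.
move=> ed x00 s0 dK x x0x.
pose v (e : R) y := e * (y `^ a * psum (damp d) y) + (- (a * K / s)) * y `^ s.
pose dv (e : R) y :=
  e * (a * y `^ (a - 1) * psum d y) + (- (a * K / s)) * (s * y `^ (s - 1)).
have key e : `|e| = 1 -> v e x <= v e x0.
  move=> e1; apply: (@le_of_derive_le0 _ (v e) (dv e)) => // y x0y.
    have y0 : 0 < y := lt_le_trans x00 x0y.
    apply: is_derive_add; apply: is_derive_scal; first exact: damp_derive.
    exact: is_derive1_powR.
  have y0 : 0 < y := lt_le_trans x00 x0y.
  rewrite /dv mulNr subr_le0 (_ : a * K / s * _ = a * K * y `^ (s - 1)); last first.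
    by rewrite mulrA divfK.
  apply: le_trans (ler_norm _) _.
  rewrite normrM e1 mul1r normrM normrM (gtr0_norm a0) (ger0_norm (powR_ge0 _ _)).
  rewrite -!mulrA ler_wpM2l ?(ltW a0)//.
  apply: le_trans (ler_wpM2l (powR_ge0 _ _) (dK _ x0y)) _.
  rewrite mulrCA -powRD ?(gt_eqF y0) ?implybT//.
  by rewrite (_ : a - 1 + (s - a) = s - 1)//; ring.
rewrite ler_norml; apply/andP; split.
  have := key (-1); rewrite normrN1 => /(_ erefl); rewrite /v.
  have := ler_norm (- (x0 `^ a * psum (damp d) x0)); rewrite normrN.
  lra.
have := key 1; rewrite normr1 => /(_ erefl); rewrite /v.
have := ler_norm (x0 `^ a * psum (damp d) x0).
lra.
Qed.

End DampedSeries.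

(** * The hypergeometric series of the multipliers *)

Section HypergeometricSeries.
Variable R : realType.
Implicit Types (a c x : R) (m : nat).

(** [psi c x] is 1F2(1; 2, c + 1; - x); by [psiE] below it is the difference
    quotient [c (1 - phi c x) / x], so that the bound [|phi c| <= 1] determines
    its sign and its decay. *)
Definition psi_coef c m : R := (-1) ^+ m / (poch (c + 1) m * m.+1`!%:R).

Definition psi c : R -> R := psum (psi_coef c).

Lemma poch1 m : poch 1 m = m`!%:R :> R.
Proof.
elim: m => [|m IH]; first by rewrite poch0.
by rewrite pochS IH factS natrM nat1r mulrC.
Qed.

Lemma poch2 m : poch 2 m = m.+1`!%:R :> R.
Proof. by rewrite -poch1 pochSl mul1r. Qed.

Lemma poch_ratio a m : 0 < a -> poch a m / poch (a + 1) m = a / (a + m%:R).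
Proof.
move=> a0; have am : a + m%:R != 0 by rewrite gt_eqF// ltr_wpDr.
have p1 : poch (a + 1) m != 0 by rewrite gt_eqF// poch_gt0// addr_gt0.
by apply/eqP; rewrite eqr_div// -pochS pochSl.
Qed.

Lemma psi_coef_exp_bounded c : 2^-1 <= c -> exp_bounded (psi_coef c).
Proof.
move=> hc; have hc1 : 2^-1 <= c + 1 by rewrite (le_trans hc)// lerDl.
apply: exp_bounded_le (phi_coef_exp_bounded hc1) _ => m.
rewrite /psi_coef /phi_coef !normrM ler_wpM2l// !normfV.
have p1 : 0 < poch (c + 1) m by rewrite poch_gt0// (lt_le_trans _ hc1).
rewrite lef_pV2 ?posrE ?normr_gt0 ?mulf_neq0 ?factR_neq0 ?(gt_eqF p1)//.
by rewrite !normrM ler_wpM2l// !ger0_norm// ler_nat factS leq_pmull.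
Qed.

Lemma psiE c x : 2^-1 <= c -> x * psi c x = c * (1 - phi c x).
Proof.
move=> hc; have c0 : 0 < c by rewrite (lt_le_trans _ hc).
have es := psi_coef_exp_bounded hc.
have phiS m : phi_coef c m.+1 = - c^-1 * psi_coef c m.
  rewrite /phi_coef /psi_coef pochSl exprS.
  have p1 : poch (c + 1) m != 0 by rewrite gt_eqF// poch_gt0// addr_gt0.
  by field; rewrite factR_neq0 p1 gt_eqF.
have phiSE : (fun m => phi_coef c m.+1)
    = (fun m => - c^-1 * psi_coef c m + 0 * psi_coef c m).
  by apply/funext => m; rewrite phiS mul0r addr0.
rewrite /phi psum_shift; last first.
  apply: exp_bounded_le (exp_bounded_diffs (phi_coef_exp_bounded hc)) _ => m.
  by rewrite /pseries_diffs [leRHS]normrM normr_nat ler_peMl// ler1n.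
rewrite phiSE psum_lin// /phi_coef poch0 fact0 expr0 mulr1 divr1 /psi.
by field; rewrite gt_eqF.
Qed.

Lemma psi0 c : 2^-1 <= c -> psi c 0 = 1.
Proof.
move=> hc; rewrite /psi psum0; last exact: psi_coef_exp_bounded.
by rewrite /psi_coef poch0 expr0 mulr1 divr1.
Qed.

Lemma psi_ge0 c x : 2^-1 <= c -> 0 <= x -> 0 <= psi c x.
Proof.
move=> hc; rewrite le_eqVlt => /predU1P[<-|x0]; first by rewrite psi0.
have c0 : 0 < c by rewrite (lt_le_trans _ hc).
rewrite -(pmulr_rge0 _ x0) psiE// mulr_ge0 ?(ltW c0)// subr_ge0.
exact: le_trans (ler_norm _) (phi_le1 hc (ltW x0)).
Qed.

Lemma psi_le c x : 2^-1 <= c -> 0 < x -> psi c x <= 2 * c / x.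
Proof.
move=> hc x0; have c0 : 0 < c by rewrite (lt_le_trans _ hc).
rewrite ler_pdivlMr// mulrC psiE// mulrC ler_wpM2r ?(ltW c0)//.
have := phi_le1 hc (ltW x0); rewrite ler_norml; lra.
Qed.

Lemma hypergeo1F2 a c x : 0 < a ->
  hypergeo [:: a] [:: c; a + 1] (- x) = psum (damp a (phi_coef c)) x.
Proof.
move=> a0; rewrite /hypergeo /psum /pseries; congr (limn (series _)).
apply/funext => m /=; rewrite !big_cons !big_nil !mulr1 /damp -poch_ratio//.
by rewrite /phi_coef [(- x) ^+ m]exprNn !invfM; ring.
Qed.

Lemma hypergeo2F3 a c x : 0 < a ->
  hypergeo [:: 1; a] [:: 2; c + 1; a + 1] (- x) = psum (damp a (psi_coef c)) x.
Proof.
move=> a0; rewrite /hypergeo /psum /pseries; congr (limn (series _)).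
apply/funext => m /=; rewrite !big_cons !big_nil !mulr1 /damp -poch_ratio//.
rewrite /psi_coef [(- x) ^+ m]exprNn !invfM poch1 poch2.
rewrite (_ : m`!%:R * poch a m * _ * _ = m`!%:R / m`!%:R * (poch a m * ((m.+1)`!%:R^-1 *
   ((poch (c + 1) m)^-1 * (poch (a + 1) m)^-1)) * ((-1) ^+ m * x ^+ m))); last by ring.
by rewrite divff ?factR_neq0//; ring.
Qed.

(** The factor [(5 / 2)_m / (3 / 2)_m = (3 + 2 m) / 3] splits as
    [(3 - 2 a) + 2 (a + m)], and [a + m] undoes the damping. *)
Lemma hypergeo3F4 a c x : 0 < a -> 2^-1 <= c ->
  3 * hypergeo [:: 1; 5 / 2; a] [:: 2; 3 / 2; c + 1; a + 1] (- x) =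
  (3 - 2 * a) * psum (damp a (psi_coef c)) x + 2 * a * psi c x.
Proof.
move=> a0 hc; have es := psi_coef_exp_bounded hc.
have ed := damp_exp_bounded a0 es.
pose e m := ((3 - 2 * a) / 3) * damp a (psi_coef c) m + (2 * a / 3) * psi_coef c m.
have -> : hypergeo [:: 1; 5 / 2; a] [:: 2; 3 / 2; c + 1; a + 1] (- x) = psum e x.
  rewrite /hypergeo /psum /pseries; congr (limn (series _)).
  apply/funext => m /=; rewrite !big_cons !big_nil !mulr1.
  have am : a + m%:R != 0 by rewrite gt_eqF// ltr_wpDr.
  have -> : e m = (3 + 2 * m%:R) / 3 * damp a (psi_coef c) m.
    by rewrite /e /damp; field.
  have -> : poch (5 / 2) m = (3 + 2 * m%:R) / 3 * poch (3 / 2) m :> R.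
    have := pochSl (3 / 2 : R) m; rewrite pochS.
    rewrite (_ : 3 / 2 + 1 = 5 / 2 :> R); last by field.
    by move=> h; apply: (@mulfI _ (3 / 2)); [lra | rewrite -h; field].
  have p32 : poch (3 / 2) m != 0 :> R by rewrite gt_eqF// poch_gt0//; lra.
  rewrite /damp -poch_ratio// /psi_coef [(- x) ^+ m]exprNn !invfM poch1 poch2.
  rewrite (_ : m`!%:R * _ * _ * _ = m`!%:R / m`!%:R * (poch (3 / 2) m / poch (3 / 2) m) *
    ((3 + 2 * m%:R) / 3 * (poch a m * ((m.+1)`!%:R^-1 *
   ((poch (c + 1) m)^-1 * (poch (a + 1) m)^-1)) * ((-1) ^+ m * x ^+ m)))); last by ring.
  by rewrite !divff ?factR_neq0//; ring.
by rewrite psum_lin// /psi; field.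
Qed.

End HypergeometricSeries.

(** * Order of the symbols *)

Section SymbolGrowth.
Variables (R : realType) (a b : R).
Hypotheses (a01 : 0 < a < 1) (hb : 2^-1 <= b).
Implicit Types x : R.

Let a0 : 0 < a. Proof. by case/andP: a01. Qed.
Let a1 : a < 1. Proof. by case/andP: a01. Qed.
Let b0 : 0 < b. Proof. exact: lt_le_trans hb. Qed.
Let hb1 : 2^-1 <= b + 1. Proof. by rewrite (le_trans hb)// lerDl. Qed.

Let F : R -> R := psum (damp a (psi_coef (b + 1))).
Let G : R -> R := psum (damp a (phi_coef (b + 1))).

Let eF := damp_exp_bounded a0 (psi_coef_exp_bounded hb1).
Let eG := damp_exp_bounded a0 (phi_coef_exp_bounded hb1).

(** As [psi (b + 1)] is nonnegative, [x ^ a * F x] is nondecreasing, which gives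
    the lower bound from any point where [F] is positive, and [F] is positive
    near the origin; as [psi (b + 1)] is [O(1 / x)] and [a < 1], the derivative
    of [x ^ a * F x] is integrable at infinity. *)
Lemma damped_psi_bounds x0 : 0 < x0 ->
  exists m M : R, 0 < m /\ forall x, x0 <= x -> m <= x `^ a * F x <= M.
Proof.
move=> x00.
have [x1 /andP[x10 x1x0] Fx1] : exists2 x1 : R, 0 < x1 <= x0 & 0 < F x1.
  have F0 : F 0 = 1 by rewrite /F psum0// /damp addr0 divff ?gt_eqF// mul1r
    /psi_coef poch0 expr0 mulr1 divr1.
  have hc : F y @[y --> (0 : R)] --> F 0 := is_derive_cts (psum_derive 0 eF).
  have := cvgr_gt _ hc 0; rewrite F0 => /(_ _ ltr01).
  move=> /nbhs_ballP[e /= e0 He].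
  exists (Num.min (e / 2) x0); first by rewrite lt_min ge_min lexx orbT divr_gt0 ?x00.
  apply: He; rewrite /ball /= sub0r normrN gtr0_norm ?lt_min ?x00 ?divr_gt0//.
  by rewrite gt_min ltr_pdivrMr// ltr_pMr// ltr1n.
have hF y : x1 <= y -> is_derive y 1 (fun y => (-1) * (y `^ a * F y))
    ((-1) * (a * y `^ (a - 1) * psi (b + 1) y)).
  move=> x1y; apply: is_derive_scal; apply: damp_derive => //.
    exact: psi_coef_exp_bounded.
  exact: lt_le_trans x1y.
exists (x1 `^ a * F x1).
(* any exponent [s] in [(a - 1, 0)] would do: [1 / y] is smaller than
   [y ^ (s - a)] at infinity, and [y ^ (s - 1)] is integrable there *)
pose s := (a - 1) / 2.
have slt0 : s < 0 by rewrite pmulr_llt0 ?invr_gt0// subr_lt0.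
have s0 : s != 0 by rewrite lt_eqF.
exists (`|x0 `^ a * F x0| + a * (2 * (b + 1) * x0 `^ s) / s * (- x0 `^ s)).
split=> [|x x0x]; first by rewrite mulr_gt0// powR_gt0.
have x1x := le_trans x1x0 x0x.
have x0' : 0 < x := lt_le_trans x00 x0x.
apply/andP; split.
  have := le_of_derive_le0 x1x hF _; rewrite !mulN1r lerN2; apply => y x1y.
  have y0 := lt_le_trans x10 x1y.
  by rewrite mulN1r oppr_le0 !mulr_ge0 ?powR_ge0 ?(ltW a0) ?psi_ge0// ltW.
apply: le_trans (ler_norm _) _.
have := @damp_growth _ a a0 _ x0 (2 * (b + 1) * x0 `^ s) s
  (psi_coef_exp_bounded hb1) x00 s0.
move=> /(_ _ _ x0x) h; apply: le_trans (h _) _ => [y x0y|].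
  have y0 := lt_le_trans x00 x0y.
  rewrite -/(psi _ _) ger0_norm ?psi_ge0 ?(ltW y0)//.
  apply: le_trans (psi_le hb1 y0) _.
  rewrite -[leRHS]mulrA ler_wpM2l ?mulr_ge0 ?addr_ge0 ?(ltW b0)//.
  have -> : s - a = - s - 1 by rewrite /s; field.
  rewrite powRD ?(gt_eqF y0) ?implybT// powR_inv1 ?(ltW y0)// mulrA.
  rewrite -[leLHS]mul1r ler_wpM2r ?invr_ge0 ?(ltW y0)//.
  rewrite powRN ler_pdivlMr ?powR_gt0// mul1r.
  rewrite -lef_pV2 ?posrE ?powR_gt0// -!powRN.
  by apply: ge0_ler_powR; rewrite ?nnegrE ?(ltW y0) ?(ltW x00)// oppr_ge0 ltW.
rewrite lerD2l; apply: ler_wnM2l.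
  rewrite mulr_ge0_le0 ?invr_le0 ?(ltW slt0)//.
  by rewrite !mulr_ge0 ?powR_ge0 ?addr_ge0 ?(ltW a0) ?(ltW b0).
by rewrite lerDr powR_ge0.
Qed.

(** [phi (b + 1)] decays like [x ^ (- 1 / 2)]; any exponent below both [a] and
    [1 / 2] survives the damping, and [a / (1 + a)] is such an exponent which
    moreover exceeds [a / 2], so that the square of the damped series is of
    smaller order than [x ^ (- a)]. *)
Lemma damped_phi_bound x0 : 0 < x0 -> exists C s : R, [/\ 0 <= C, 0 < s &
  forall x, x0 <= x -> x `^ a * G x ^+ 2 <= C * x `^ (- s)].
Proof.
move=> x00; pose s := a - a / (1 + a); pose K : R := Num.max 1 b.
have a10 : 0 < 1 + a by rewrite addr_gt0.
have s0 : 0 < s.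
  rewrite /s (_ : _ - _ = a * a / (1 + a)); first by rewrite divr_gt0 ?mulr_gt0.
  by field; rewrite gt_eqF.
have K0 : 0 <= K by rewrite /K le_max ler01.
have phiK y : x0 <= y -> `|psum (phi_coef (b + 1)) y| <= K * y `^ (s - a).
  move=> x0y; have y0 := lt_le_trans x00 x0y.
  have -> : s - a = - (a / (1 + a)) by rewrite /s; ring.
  have g0 : 0 <= a / (1 + a) by rewrite divr_ge0 ?(ltW a0) ?(ltW a10).
  rewrite powRN ler_pdivlMr ?powR_gt0//; have [y1|y1] := leP y 1.
    apply: le_trans (_ : 1 * 1 <= _); last by rewrite mulr1 le_max lexx.
    apply: ler_pM; rewrite ?powR_ge0 ?(phi_le1 hb1) ?(ltW y0)//.
    by apply: le_trans (ge0_ler_powR g0 _ _ y1) _; rewrite ?nnegrE ?(ltW y0) ?powR1.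
  apply: le_trans (_ : b <= _); last by rewrite le_max lexx orbT.
  rewrite -ler_pdivlMr ?powR_gt0//; apply: le_trans (phi_decay hb y0) _.
  rewrite ler_wpM2l ?(ltW b0)// lef_pV2 ?posrE ?powR_gt0 ?sqrtr_gt0//.
  rewrite -powR12_sqrt ?(ltW y0)//; apply: ler_powR; first exact: ltW.
  by rewrite ler_pdivrMr//; move: a1; lra.
have := @damp_growth _ a a0 _ x0 K s (phi_coef_exp_bounded hb1) x00 (lt0r_neq0 s0) phiK.
rewrite -/G => hG; set A := `|_ * G x0| in hG.
pose C := A / x0 `^ s + a * K / s.
have C0 : 0 <= C.
  by rewrite addr_ge0 ?divr_ge0 ?powR_ge0 ?mulr_ge0 ?normr_ge0 ?(ltW a0) ?(ltW s0).
have CG x : x0 <= x -> `|x `^ a * G x| <= C * x `^ s.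
  move=> x0x; apply: le_trans (hG _ x0x) _; rewrite /C mulrDl; apply: lerD.
    rewrite -mulrA; apply: ler_peMr; first exact: normr_ge0.
    rewrite mulrC ler_pdivlMr ?powR_gt0// mul1r.
    by apply: ge0_ler_powR; rewrite ?nnegrE ?(ltW s0) ?(ltW x00)// (le_trans (ltW x00)).
  rewrite ler_wpM2l ?divr_ge0 ?mulr_ge0 ?(ltW a0) ?(ltW s0)//.
  by rewrite gerBl powR_ge0.
exists (C ^+ 2), (a - 2 * s); split; first exact: sqr_ge0.
  rewrite /s (_ : _ - _ = a * (1 - a) / (1 + a)); last by field; rewrite gt_eqF.
  by rewrite divr_gt0 ?mulr_gt0// subr_gt0.
move=> x x0x; have y0 := lt_le_trans x00 x0x.
have xa0 : 0 < x `^ a by rewrite powR_gt0.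
rewrite -(ler_pM2l xa0) (_ : _ * (_ * _) = (x `^ a * G x) ^+ 2); last by ring.
have -> : x `^ a * (C ^+ 2 * x `^ (- (a - 2 * s))) = (C * x `^ s) ^+ 2.
  rewrite mulrCA -powRD ?(gt_eqF y0) ?implybT// exprMn; congr (_ * _).
  by rewrite -powR_mulrn ?powR_ge0// -powRrM; congr (_ `^ _); ring.
rewrite -[leLHS]ger0_norm ?sqr_ge0// normrX.
by rewrite ler_sqr ?nnegrE ?CG// mulr_ge0 ?powR_ge0.
Qed.

Lemma powR_small (K e s : R) : 0 <= K -> 0 < e -> 0 < s ->
  exists2 X, 0 < X & forall x, X <= x -> K * x `^ (- s) <= e.
Proof.
move=> K0 e0 s0; exists (((K + 1) / e) `^ s^-1).
  by rewrite powR_gt0 ?divr_gt0 ?ltr_wpDl.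
move=> x Xx; have K1 : 0 < (K + 1) / e by rewrite divr_gt0 ?ltr_wpDl.
have x0 : 0 < x by apply: lt_le_trans Xx; rewrite powR_gt0.
rewrite powRN ler_pdivrMr ?powR_gt0//.
have : (K + 1) / e <= x `^ s.
  have -> : (K + 1) / e = (((K + 1) / e) `^ s^-1) `^ s.
    by rewrite -powRrM mulVf ?gt_eqF// powRr1 ?ltW.
  by apply: ge0_ler_powR; rewrite ?nnegrE ?powR_ge0 ?(ltW s0) ?(ltW x0).
rewrite ler_pdivrMr// => h; rewrite mulrC; apply: le_trans h.
by rewrite lerDl.
Qed.

Variables (mu kappa : R).
Hypothesis mu0 : 0 < mu.

(** The positive combination [(3 - 2 a) F + 2 a psi] has exact order
    [x ^ (- a)]; the square of [G] is of smaller order whatever the sign of its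
    coefficient, and on a bounded range the lower bound comes from
    compactness. *)
Lemma longitudinal_symbol_bounds (L : R -> R) x0 :
  (forall x, L x = mu * ((3 - 2 * a) * F x + 2 * a * psi (b + 1) x)
                   + kappa * G x ^+ 2) ->
  (forall x, 0 < x -> 0 < L x) -> 0 < x0 ->
  exists m M : R, 0 < m /\ forall x, x0 <= x -> m <= x `^ a * L x <= M.
Proof.
move=> LE Lgt0 x00.
have [m1 [M1 [m10 hF]]] := damped_psi_bounds x00.
have [C [s [C0 s0 hG]]] := damped_phi_bound x00.
have a32 : 0 < 3 - 2 * a by move: a1; lra.
pose m2 := mu * ((3 - 2 * a) * m1).
have m20 : 0 < m2 by rewrite !mulr_gt0.
have m22 : 0 < m2 / 2 by rewrite divr_gt0.
have kC0 : 0 <= `|kappa| * C by rewrite mulr_ge0.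
have [X X0 hX] := powR_small kC0 m22 s0.
have xG x : x0 <= x -> `|x `^ a * (kappa * G x ^+ 2)| <= `|kappa| * C * x `^ (- s).
  move=> x0x; rewrite mulrCA normrM -mulrA ler_wpM2l// ger0_norm ?hG//.
  by rewrite mulr_ge0 ?powR_ge0 ?sqr_ge0.
have LE' x : x `^ a * L x = mu * ((3 - 2 * a) * (x `^ a * F x)
      + 2 * a * (x `^ a * psi (b + 1) x)) + x `^ a * (kappa * G x ^+ 2).
  by rewrite LE; ring.
have lowX x : x0 <= x -> X <= x -> m2 / 2 <= x `^ a * L x.
  move=> x0x Xx; have y0 := lt_le_trans x00 x0x.
  have := le_trans (xG _ x0x) (hX _ Xx); rewrite LE' ler_norml => /andP[h _].
  have [Fm _] := andP (hF _ x0x).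
  have h2 : m2 <= mu * ((3 - 2 * a) * (x `^ a * F x) + 2 * a * (x `^ a * psi (b + 1) x)).
    rewrite /m2 ler_wpM2l ?(ltW mu0)//; apply: ler_wpDr.
      by rewrite !mulr_ge0 ?powR_ge0 ?(ltW a0) ?psi_ge0// ltW.
    by rewrite ler_wpM2l// ltW.
  lra.
pose P x := x `^ a * L x.
have cP x : 0 < x -> {for x, continuous P}.
  move=> xpos; rewrite /P.
  have cpow : {for x, continuous (@powR R ^~ a)}.
    exact: is_derive_cts (is_derive1_powR a xpos).
  have cF : {for x, continuous F} := is_derive_cts (psum_derive x eF).
  have cG : {for x, continuous G} := is_derive_cts (psum_derive x eG).
  have cS : {for x, continuous (psi (b + 1))}.
    exact: is_derive_cts (psum_derive x (psi_coef_exp_bounded hb1)).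
  rewrite (_ : (fun x => _) = (fun x => x `^ a *
      (mu * ((3 - 2 * a) * F x + 2 * a * psi (b + 1) x)
       + kappa * (G x * G x)))); last first.
    by apply/funext => y; rewrite LE expr2.
  apply: cvgM; first exact: cpow.
  apply: cvgD; apply: cvgMr.
    by apply: cvgD; apply: cvgMr.
  exact: cvgM.
pose Y := Num.max x0 X.
have x0Y : x0 <= Y by rewrite le_max lexx.
have cPY : {within `[x0, Y], continuous P}.
  apply: continuous_in_subspaceT => y; rewrite inE/= in_itv/= => /andP[x0y _].
  by apply: cP; exact: lt_le_trans x0y.
have [y] := EVT_min x0Y cPY; rewrite in_itv/= => /andP[x0y _] ymin.
have y0 := lt_le_trans x00 x0y.
exists (Num.min (P y) (m2 / 2)).
exists (mu * ((3 - 2 * a) * M1 + 2 * a * (2 * (b + 1) * x0 `^ (a - 1)))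
        + `|kappa| * C * x0 `^ (- s)); split.
  by rewrite lt_min m22 andbT mulr_gt0 ?powR_gt0 ?Lgt0.
move=> x x0x; have xpos := lt_le_trans x00 x0x; apply/andP; split.
  rewrite ge_min; have [xY|/ltW Yx] := leP x Y.
    by rewrite ymin// in_itv/= x0x.
  by rewrite orbC lowX//; apply: le_trans Yx; rewrite le_max lexx orbT.
have pow_le (r : R) : 0 <= r -> x `^ (- r) <= x0 `^ (- r).
  move=> r0; rewrite !powRN lef_pV2 ?posrE ?powR_gt0//.
  by apply: ge0_ler_powR; rewrite ?nnegrE ?(ltW x00) ?(ltW xpos).
rewrite LE'; apply: lerD; last first.
  apply: le_trans (ler_norm _) _; apply: le_trans (xG _ x0x) _.
  by rewrite ler_wpM2l// pow_le// ltW.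
rewrite ler_wpM2l ?(ltW mu0)//; apply: lerD.
  by rewrite ler_wpM2l ?(ltW a32)//; case/andP: (hF _ x0x).
rewrite ler_wpM2l ?mulr_ge0 ?(ltW a0)//.
apply: le_trans (ler_wpM2l (powR_ge0 _ _) (psi_le hb1 xpos)) _.
rewrite mulrCA ler_wpM2l ?mulr_ge0 ?addr_ge0 ?(ltW b0)//.
rewrite -powR_inv1 ?(ltW xpos)// -powRD ?(gt_eqF xpos) ?implybT//.
by rewrite (_ : a - 1 = - (1 - a)) ?pow_le ?subr_ge0 ?(ltW a1)//; ring.
Qed.

End SymbolGrowth.

(** * Order of the multipliers *)

Section MultiplierGrowth.
Variables (R : realType) (n : nat) (delta beta mu lams : R).
Hypotheses (n0 : (0 < n)%N) (delta0 : 0 < delta).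
Hypothesis hbeta : n%:R < beta < n%:R + 2.
Hypothesis mu0 : 0 < mu.
Hypothesis lambda1_lt0 : forall nu : 'cV[R]_n,
  nu != 0 -> lambda1 delta beta mu lams nu < 0.

Let a : R := (n%:R + 2 - beta) / 2.
Let b : R := n%:R / 2.
Let eta : R := (beta - n%:R) / 2.
Let F : R -> R := psum (damp a (psi_coef (b + 1))).
Let G : R -> R := psum (damp a (phi_coef (b + 1))).
Let L x : R := mu * ((3 - 2 * a) * F x + 2 * a * psi (b + 1) x)
               + (lams - mu) * G x ^+ 2.
Let y_ (nu : 'cV[R]_n) : R := 4^-1 * sqnorm nu * delta ^+ 2.

Let a01 : 0 < a < 1.
Proof.
case/andP: hbeta => h1 h2; rewrite /a; apply/andP; split.
  by rewrite divr_gt0// subr_gt0.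
by rewrite ltr_pdivrMr// mul1r ltrBlDr addrC ltrD2l.
Qed.

Let a0 : 0 < a. Proof. by case/andP: a01. Qed.

Let hb : 2^-1 <= b.
Proof. by rewrite /b -[leLHS]mul1r ler_wpM2r// ler1n. Qed.

Let cE : (n%:R + 2) / 2 = b + 1 :> R. Proof. by rewrite /b; field. Qed.
Let c1E : (n%:R + 4) / 2 = b + 1 + 1 :> R. Proof. by rewrite /b; field. Qed.
Let a1E : (n%:R + 4 - beta) / 2 = a + 1. Proof. by rewrite /a; field. Qed.

Lemma lambda2E nu : lambda2 delta beta mu nu = - (mu * (sqnorm nu * F (y_ nu))).
Proof. by rewrite /lambda2 c1E a1E hypergeo2F3// !mulNr -mulrA. Qed.

Lemma lambda1E nu : lambda1 delta beta mu lams nu = - (sqnorm nu * L (y_ nu)).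
Proof.
have hb1 : 2^-1 <= b + 1 by rewrite (le_trans hb)// lerDl.
rewrite /lambda1 cE c1E a1E hypergeo1F2// mulNr.
by rewrite [3 * mu]mulrC -[mu * 3 * _]mulrA hypergeo3F4.
Qed.

(* every positive argument of the symbol is attained, so the sign condition on
   [lambda1] is one on the function [L] *)
Let sqnorm_onto (r : R) : 0 < r -> exists2 nu : 'cV[R]_n, nu != 0 & sqnorm nu = r.
Proof.
move=> r0; pose nu : 'cV[R]_n := \col_i (Num.sqrt r *+ (i == Ordinal n0)).
have nuE : sqnorm nu = r.
  rewrite /sqnorm (bigD1 (Ordinal n0))//= mxE eqxx mulr1n sqr_sqrtr ?(ltW r0)//.
  by rewrite big1 ?addr0// => i /negPf ne; rewrite mxE ne expr0n.
by exists nu => //; rewrite -sqnorm_eq0 nuE gt_eqF.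
Qed.

Let L_gt0 x : 0 < x -> 0 < L x.
Proof.
move=> x0; have d2 : 0 < delta ^+ 2 by rewrite exprn_gt0.
have r0 : 0 < 4 * x / delta ^+ 2 by rewrite divr_gt0// mulr_gt0.
have [nu nu0 nuE] := sqnorm_onto r0.
have := lambda1_lt0 nu0; rewrite lambda1E oppr_lt0 nuE pmulr_rgt0//.
by rewrite /y_ nuE (_ : 4^-1 * _ * _ = x)//; field; rewrite gt_eqF.
Qed.

(** [y_ nu] is a multiple of [sqnorm nu], so a symbol of exact order [x ^ (- a)]
    gives a multiplier of exact order [sqnorm nu ^ (1 - a)], and [1 - a = eta];
    [1 + sqnorm nu <= 2 * sqnorm nu] accounts for the loss in the lower bound. *)
Lemma symbol_scaling (H : R -> R) :
  (exists m M : R, 0 < m /\ forall x, delta ^+ 2 / 4 <= x -> m <= x `^ a * H x <= M) ->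
  exists m M : R, [/\ 0 < m, 0 < M & forall nu : 'cV[R]_n, 1 <= sqnorm nu ->
    m * (1 + sqnorm nu) `^ eta <= sqnorm nu * H (y_ nu) <= M * (1 + sqnorm nu) `^ eta].
Proof.
move=> [m [M [m0 hH]]].
have d0 : 0 < delta ^+ 2 / 4 by rewrite divr_gt0// exprn_gt0.
have eta0 : 0 < eta by case/andP: hbeta => h _; rewrite /eta divr_gt0// subr_gt0.
pose k := (delta ^+ 2 / 4) `^ (- a).
have k0 : 0 < k by rewrite powR_gt0.
have M0 : 0 < M.
  by apply: lt_le_trans m0 _; case/andP: (hH _ (lexx _)) => /le_trans; apply.
have t0 : 0 < (2 : R) `^ eta by rewrite powR_gt0.
exists (m * k / 2 `^ eta), (M * k).
split; [by rewrite divr_gt0 ?mulr_gt0|by rewrite mulr_gt0|].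
move=> nu; set N := sqnorm nu => N1.
have N0 : 0 < N := lt_le_trans ltr01 N1.
have yE : y_ nu = N * (delta ^+ 2 / 4) by rewrite /y_ -/N; field.
have yge : delta ^+ 2 / 4 <= y_ nu by rewrite yE ler_peMl// ltW.
have y0 : 0 < y_ nu := lt_le_trans d0 yge.
have -> : N * H (y_ nu) = k * N `^ eta * (y_ nu `^ a * H (y_ nu)).
  rewrite mulrA; congr (_ * _); rewrite yE powRM ?(ltW N0) ?(ltW d0)//.
  rewrite (_ : eta = 1 - a); last by rewrite /eta /a; field.
  rewrite powRD ?(gt_eqF N0) ?implybT// powRr1 ?(ltW N0)// /k !powRN.
  by field; rewrite !gt_eqF ?powR_gt0.
have N2 : (1 + N) `^ eta <= 2 `^ eta * N `^ eta.
  rewrite -powRM ?(ltW N0)//.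
  apply: ge0_ler_powR; rewrite ?nnegrE ?(ltW eta0) ?addr_ge0 ?mulr_ge0 ?(ltW N0)//.
  by rewrite mulr_natl mulr2n lerD2r.
have N3 : N `^ eta <= (1 + N) `^ eta.
  by apply: ge0_ler_powR; rewrite ?nnegrE ?(ltW eta0) ?addr_ge0 ?(ltW N0)// lerDr.
have /andP[h1 h2] := hH _ yge; apply/andP; split.
  rewrite (_ : m * k / _ * _ = k * m * ((1 + N) `^ eta / 2 `^ eta)); last by ring.
  rewrite -mulrA -mulrA ler_wpM2l ?(ltW k0)// mulrC.
  apply: ler_pM; rewrite ?divr_ge0 ?powR_ge0 ?(ltW m0)//.
  by rewrite ler_pdivrMr// mulrC.
rewrite [leRHS](_ : _ = k * (1 + N) `^ eta * M); last by ring.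
apply: ler_pM => //; first by rewrite mulr_ge0 ?powR_ge0 ?(ltW k0).
  exact: le_trans (ltW m0) h1.
by rewrite ler_wpM2l ?(ltW k0).
Qed.

Lemma lambda2_growth : exists m M : R, [/\ 0 < m, 0 < M &
  forall nu : 'cV[R]_n, 1 <= sqnorm nu ->
    m * (1 + sqnorm nu) `^ eta <= - lambda2 delta beta mu nu
      <= M * (1 + sqnorm nu) `^ eta].
Proof.
have d0 : 0 < delta ^+ 2 / 4 by rewrite divr_gt0// exprn_gt0.
have [m [M [m0 M0 h]]] := symbol_scaling (damped_psi_bounds a01 hb d0).
exists (mu * m), (mu * M); split; [exact: mulr_gt0|exact: mulr_gt0|move=> nu /h].
by rewrite lambda2E opprK -!mulrA !ler_pM2l.
Qed.

Lemma lambda1_growth : exists m M : R, [/\ 0 < m, 0 < M &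
  forall nu : 'cV[R]_n, 1 <= sqnorm nu ->
    m * (1 + sqnorm nu) `^ eta <= - lambda1 delta beta mu lams nu
      <= M * (1 + sqnorm nu) `^ eta].
Proof.
have d0 : 0 < delta ^+ 2 / 4 by rewrite divr_gt0// exprn_gt0.
have [m [M [m0 M0 h]]] := symbol_scaling (longitudinal_symbol_bounds a01 hb mu0
  (fun x => erefl (L x)) L_gt0 d0).
by exists m, M; split=> // nu /h; rewrite lambda1E opprK.
Qed.

End MultiplierGrowth.

(** * A lattice sum *)

Section LatticeSum.
Variable R : realType.

Let w (j : int) : R := (1 + (j%:~R) ^+ 2)^-1.

Let w_ge0 j : 0 <= w j.
Proof. by rewrite invr_ge0 addr_ge0 ?sqr_ge0. Qed.

(** Telescoping, as [1 / (1 + m ^ 2) <= 4 / ((m + 1) (m + 2))]. *)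
Lemma sum_inv_1Dsqr M : \sum_(m < M) (1 + m%:R ^+ 2)^-1 <= 4 - 4 / (M%:R + 1) :> R.
Proof.
elim: M => [|M IH]; first by rewrite big_ord0 add0r divr1 subrr.
rewrite big_ord_recr /=; apply: le_trans (lerD IH (lexx _)) _.
have M0 : 0 <= M%:R :> R by [].
rewrite -subr_ge0 -natr1; set x := M%:R in M0 *.
have p1 : 0 < x + 1 by rewrite ltr_wpDl.
have p2 : 0 < x + 1 + 1 by rewrite addr_gt0.
have p3 : 0 < 1 + x ^+ 2 by rewrite ltr_wpDr ?sqr_ge0.
rewrite (_ : _ - _ = (3 * x ^+ 2 - 3 * x + 2) / ((x + 1) * (x + 1 + 1) * (1 + x ^+ 2))).
  by apply: divr_ge0; [nra | rewrite !mulr_ge0// ltW].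
by field; rewrite !gt_eqF.
Qed.

Let box M (j : ('I_M + 'I_M)%type) : int :=
  match j with inl m => Posz m | inr m => Negz m end.

Let box_onto M (z : int) : (`|z| < M)%N -> exists j : 'I_M + 'I_M, box j = z.
Proof.
case: z => m zM; first by exists (inl (Ordinal zM)).
by exists (inr (Ordinal (ltnW zM))).
Qed.

Let box_inj M : injective (@box M).
Proof.
move=> [i|i] [j|j] //= []; first by move=> /val_inj ->.
by move=> /val_inj ->.
Qed.

Let sum_box M : \sum_(j : 'I_M + 'I_M) w (box j) <= 8.
Proof.
rewrite big_sumType /=.
have h : \sum_(m < M) w (Posz m) <= 4.
  apply: le_trans (sum_inv_1Dsqr M) _.
  by rewrite gerBl divr_ge0// addr_ge0.
rewrite (_ : 8 = 4 + 4); last by ring.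
apply: lerD => //; apply: le_trans h; apply: ler_sum => m _.
rewrite /w lef_pV2 ?posrE ?ltr_wpDr ?sqr_ge0// lerD2l NegzE mulrNz sqrrN.
by apply: lerXn2r; rewrite ?nnegrE ?ler0z// ler_int lez_nat leqnSn.
Qed.

Lemma sum_seq_le (I : eqType) (r s : seq I) (W : I -> R) :
  (forall i, 0 <= W i) -> uniq r -> uniq s ->
  (forall i, i \in r -> i \in s) ->
  \sum_(i <- r) W i <= \sum_(i <- s) W i.
Proof.
move=> W0 ur us rs.
have p : perm_eq r [seq i <- s | i \in r].
  apply: uniq_perm; rewrite ?filter_uniq// => i; rewrite mem_filter.
  by case: (boolP (i \in r)) => // /rs ->.
rewrite (perm_big _ p) big_filter [leRHS](bigID (fun i => i \in r))/= lerDl.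
by apply: sumr_ge0.
Qed.

(** [(1 + |k| ^ 2) ^ n] dominates the product of the [1 + k_i ^ 2], so that the
    lattice sum is bounded by the [n]-th power of a one-dimensional sum. *)
Lemma lattice_sum_bounded n : exists S : R, forall A : {fset 'cV[int]_n},
  \sum_(k <- A) (1 + sqnorm (zvec R k)) `^ (- n%:R) <= S.
Proof.
exists (8 ^+ n) => A.
pose W (k : 'cV[int]_n) := \prod_(i < n) w (k i 0).
have W0 k : 0 <= W k by rewrite prodr_ge0.
apply: (@le_trans _ _ (\sum_(k <- A) W k)).
  apply: ler_sum => k _.
  have N0 : 0 <= sqnorm (zvec R k) by apply: sumr_ge0 => i _; exact: sqr_ge0.
  rewrite powR_invn ?addr_ge0// /W prodfV lef_pV2; last first.
  - by rewrite posrE prodr_gt0// => i _; rewrite ltr_wpDr ?sqr_ge0.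
  - by rewrite posrE exprn_gt0// ltr_wpDr.
  have -> : (1 + sqnorm (zvec R k)) ^+ n = \prod_(i < n) (1 + sqnorm (zvec R k)).
    by rewrite prodr_const card_ord.
  apply: ler_prod => i _.
  rewrite addr_ge0 ?sqr_ge0//= lerD2l /sqnorm (bigD1 i)//= mxE lerDl.
  by apply: sumr_ge0 => j _; exact: sqr_ge0.
(* [A] lies in the image [h] of a box, where the sum of products is a product of
   sums *)
pose M := (\max_(k <- A) \max_(i < n) `|k i (0 : 'I_1)%R|%N).+1.
pose h (f : {ffun 'I_n -> 'I_M + 'I_M}) : 'cV[int]_n := \col_i box (f i).
have h_inj : injective h.
  move=> f g /matrixP fg; apply/ffunP => i.
  by have := fg i 0; rewrite !mxE => /box_inj.
apply: (@le_trans _ _ (\sum_(k <- [seq h f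
    | f <- enum [set: {ffun 'I_n -> 'I_M + 'I_M}]%SET]) W k)).
  apply: sum_seq_le => //; first by rewrite map_inj_uniq ?enum_uniq.
  move=> k kA.
  have kM i : exists j : 'I_M + 'I_M, box j = k i 0.
    apply: box_onto; rewrite ltnS.
    pose g (k : 'cV[int]_n) := \max_(i < n) `|k i (0 : 'I_1)%R|%N.
    have h1 : (`|k i (0 : 'I_1)%R| <= g k)%N.
      exact: (@leq_bigmax _ (fun i : 'I_n => `|k i (0 : 'I_1)%R|%N) i).
    exact: leq_trans h1 (@leq_bigmax_seq _ _ xpredT g k kA isT).
  have [f fE] := choice kM.
  apply/mapP; exists [ffun i => f i]; first by rewrite mem_enum inE.
  by apply/matrixP => i j; rewrite ord1 mxE ffunE fE.
rewrite big_map big_enum /=.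
rewrite (eq_bigl xpredT) => [|f]; last by rewrite inE.
rewrite (eq_bigr (fun f : {ffun 'I_n -> 'I_M + 'I_M} =>
    \prod_(i < n) w (box (f i)))); last first.
  by move=> f _; apply: eq_bigr => i _; rewrite mxE.
rewrite -(bigA_distr_bigA (fun (i : 'I_n) j => w (box j))) /=.
have -> : 8 ^+ n = \prod_(i < n) 8 :> R by rewrite prodr_const card_ord.
by apply: ler_prod => i _; rewrite sum_box andbT sumr_ge0.
Qed.

End LatticeSum.

(** * Unordered sums *)

Section UnorderedRealSums.
Variables (R : realType) (I : choiceType) (D : set I).
Implicit Types (a M : I -> R) (A B : {fset I}).

Lemma fset_sum_split (V : zmodType) (P : pred I) (F : I -> V) A B : fsubset A B ->
  \sum_(i <- B | P i) F i
  = \sum_(i <- A | P i) F i + \sum_(i <- B | P i && (i \notin A)) F i.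
Proof.
move=> AB; rewrite (bigID (fun i => i \in A))/=; congr (_ + _).
have p : perm_eq A [seq i <- B | i \in A].
  apply: uniq_perm; rewrite ?filter_uniq ?fset_uniq// => i; rewrite mem_filter.
  by case: (boolP (i \in A)) => // /(fsubsetP AB) ->.
by rewrite (perm_big _ p) big_filter_cond; apply: eq_bigl => i; rewrite andbC.
Qed.

Definition bounded_sums a : Prop :=
  exists S : R, forall A, \sum_(i <- A | i \in D) `|a i| <= S.

Lemma near_finsets A : \forall B \near @finsets I, fsubset A B.
Proof. by exists A. Qed.

(** The net of partial sums is nondecreasing, hence converges to its supremum. *)
Lemma usum_cvg_ge0 a : (forall i, 0 <= a i) -> bounded_sums a ->
  exists2 l, partial_sum D a @ @finsets I --> l
    & forall A, partial_sum D a A <= l.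
Proof.
move=> a0 [S aS]; pose E := range (partial_sum D a).
have supE : has_sup E.
  split; first by exists (partial_sum D a fset0), fset0.
  exists S => _ [A _ <-]; apply: le_trans (aS A).
  by apply: ler_sum => i _; exact: ler_norm.
have leE A : partial_sum D a A <= sup E by apply: ub_le_sup; [case: supE | exists A].
exists (sup E) => //; apply/cvgrPdist_le => e e0.
have [_ [A _ <-] hA] := sup_adherent e0 supE.
near=> B; have AB : fsubset A B by near: B; exact: near_finsets.
rewrite ger0_norm ?subr_ge0// lerBlDr -lerBlDl; apply: le_trans (ltW hA) _.
by rewrite /partial_sum (fset_sum_split _ _ AB) lerDl sumr_ge0.
Unshelve. all: by end_near. Qed.

Lemma bounded_sums_le a M : (forall i, i \in D -> `|a i| <= M i) ->
  bounded_sums M -> bounded_sums a.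
Proof.
move=> aM [S MS]; exists S => A; apply: le_trans (MS A).
by apply: ler_sum => i iD; apply: le_trans (aM i iD) (ler_norm _).
Qed.

Lemma bounded_sums_norm a : bounded_sums a -> bounded_sums (fun i => `|a i|).
Proof. by move=> [S aS]; exists S => A; under eq_bigr do rewrite normr_id. Qed.

(** Write [a] as the difference of the nonnegative families [|a| + a] and
    [|a|]. *)
Lemma bounded_sums_cvg a : bounded_sums a ->
  partial_sum D a @ @finsets I --> usum D a.
Proof.
move=> ab; rewrite /usum.
have [l hl _] : exists2 l, partial_sum D (fun i => `|a i|) @ @finsets I --> l
    & forall A, partial_sum D (fun i => `|a i|) A <= l.
  by apply: usum_cvg_ge0 => //; exact: bounded_sums_norm.
have [k hk _] : exists2 l, partial_sum D (fun i => `|a i| + a i) @ @finsets I --> l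
    & forall A, partial_sum D (fun i => `|a i| + a i) A <= l.
  apply: usum_cvg_ge0 => [i|]; first by have := ler_norm (- a i); rewrite normrN; lra.
  have [S aS] := ab; exists (2 * S) => A.
  apply: (@le_trans _ _ (2 * \sum_(i <- A | i \in D) `|a i|)).
    rewrite mulr_sumr; apply: ler_sum => i _; apply: le_trans (ler_normD _ _) _.
    by rewrite normr_id mulr_natl mulr2n.
  by rewrite ler_pM2l.
apply: (cvgP (k - l)).
suff -> : partial_sum D a = partial_sum D (fun i => `|a i| + a i)
    \- partial_sum D (fun i => `|a i|) by exact: cvgB.
apply/funext => A; rewrite /partial_sum /= -sumrB.
by apply: eq_bigr => i _; rewrite addrAC subrr add0r.
Qed.

Lemma bounded_sums_tail a (e : R) : bounded_sums a -> 0 < e ->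
  exists A, forall B, fsubset A B ->
    \sum_(i <- B | (i \in D) && (i \notin A)) `|a i| <= e.
Proof.
move=> ab e0.
have [l hl lel] : exists2 l, partial_sum D (fun i => `|a i|) @ @finsets I --> l
    & forall A, partial_sum D (fun i => `|a i|) A <= l.
  by apply: usum_cvg_ge0 => //; exact: bounded_sums_norm.
have /cvgrPdist_le/(_ e e0)[A _ hA] := hl; exists A => B AB.
have := lel B; rewrite /partial_sum (fset_sum_split _ _ AB).
have := hA A (fsubset_refl A); rewrite /= ger0_norm ?subr_ge0//= /partial_sum.
by move=> h1 h2; rewrite -(lerD2l (\sum_(i <- A | i \in D) `|a i|)); lra.
Qed.

Lemma cvg_fset_sum (T : Type) (F : set_system T) {FF : Filter F}
    (d : T -> I -> R) (l : I -> R) A :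
  (forall i, i \in D -> d s i @[s --> F] --> l i) ->
  \sum_(i <- A | i \in D) d s i @[s --> F] --> \sum_(i <- A | i \in D) l i.
Proof.
move=> dl; elim: (enum_fset A) => [|i r IH].
  by rewrite big_nil; under eq_fun do rewrite big_nil; exact: cvg_cst.
rewrite big_cons; under eq_fun do rewrite big_cons.
by case: ifPn => // iD; apply: cvgD => //; exact: dl.
Qed.

(** Dominated convergence for unordered sums: the majorant leaves a small tail
    outside of a finite set, on which the convergence is that of finitely many
    terms. *)
Lemma dominated_usum (T : Type) (F : set_system T) {FF : Filter F}
    (d : T -> I -> R) (l M : I -> R) :
  bounded_sums M ->
  (forall s i, i \in D -> `|d s i| <= M i) ->
  (forall i, i \in D -> `|l i| <= M i) ->
  (forall i, i \in D -> d s i @[s --> F] --> l i) ->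
  usum D (d s) @[s --> F] --> usum D l.
Proof.
move=> bM dM lM dl; apply/cvgrPdist_le => e e0.
have e3 : 0 < e / 3 by rewrite divr_gt0.
have [A hA] := bounded_sums_tail bM e3.
have hfin : \sum_(i <- A | i \in D) `|l i - d s i| @[s --> F] --> (0 : R).
  rewrite [X in _ --> X](_ : 0 = \sum_(i <- A | i \in D) (0 : R)); last by rewrite big1.
  apply: (@cvg_fset_sum T F FF (fun s i => `|l i - d s i|) (fun=> 0)) => i iD.
  have : `|l i - d s i| @[s --> F] --> `|l i - l i|.
    by apply: cvg_norm; apply: cvgB; [exact: cvg_cst | exact: dl].
  by rewrite subrr normr0.
have hle := cvgr_le _ hfin _ e3.
near=> s.
have hs : \sum_(i <- A | i \in D) `|l i - d s i| <= e / 3 by near: s; exact: hle.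
have cd := bounded_sums_cvg (bounded_sums_le (dM s) bM).
have cl := bounded_sums_cvg (bounded_sums_le lM bM).
apply: cvgr_to_le (cvg_norm (cvgB cl cd)) _; near=> B.
have AB : fsubset A B by near: B; exact: near_finsets.
have hB := hA B AB.
rewrite fctE /partial_sum -sumrB.
apply: le_trans (ler_norm_sum _ _ _) _.
rewrite (fset_sum_split _ _ AB).
apply: (@le_trans _ _ (e / 3 + 2 * (e / 3))); last by lra.
apply: lerD; first exact: hs.
apply: (@le_trans _ _ (2 * \sum_(i <- B | (i \in D) && (i \notin A)) `|M i|));
  last by lra.
rewrite mulr_sumr; apply: ler_sum => i /andP[iD _].
apply: le_trans (ler_normB _ _) _; rewrite mulr_natl mulr2n.
by apply: lerD; apply: le_trans (ler_norm _); [exact: lM | exact: dM].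
Unshelve. all: by end_near. Qed.

End UnorderedRealSums.

Section SumAlgebra.
Variables (R : realType) (I : choiceType) (D : set I).
Implicit Types (a b : I -> R).

Lemma bounded_sumsZ (c : R) a : bounded_sums D a -> bounded_sums D (fun k => c * a k).
Proof.
move=> [S aS]; exists (`|c| * S) => A; under eq_bigr do rewrite normrM.
by rewrite -mulr_sumr ler_wpM2l.
Qed.

Lemma bounded_sumsD a b : bounded_sums D a -> bounded_sums D b ->
  bounded_sums D (fun k => a k + b k).
Proof.
move=> [S aS] [T bT]; exists (S + T) => A; apply: le_trans (lerD (aS A) (bT A)).
by rewrite -big_split; apply: ler_sum => i _; exact: ler_normD.
Qed.

Lemma usum_lin (x y : R) a b : bounded_sums D a -> bounded_sums D b ->
  usum D (fun k => x * a k + y * b k) = x * usum D a + y * usum D b.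
Proof.
move=> /bounded_sums_cvg ca /bounded_sums_cvg cb; apply: cvg_lim => //.
rewrite [X in X @ _](_ : _ = (fun A => x * partial_sum D a A + y * partial_sum D b A)).
  by apply: cvgD; apply: cvgMr.
apply/funext => A; rewrite /partial_sum !mulr_sumr -big_split /=.
by apply: eq_bigr.
Qed.

Lemma eq_usum a b : (forall k, k \in D -> a k = b k) -> usum D a = usum D b.
Proof.
move=> ab; rewrite /usum; have -> // : partial_sum D a = partial_sum D b.
by apply/funext => A; apply: eq_bigr => k /ab.
Qed.

Lemma eq_bounded_sums a b : (forall k, k \in D -> a k = b k) ->
  bounded_sums D b -> bounded_sums D a.
Proof.
move=> ab [S bS]; exists S => A; under eq_bigr => k kD do rewrite (ab k kD).
exact: bS.
Qed.

End SumAlgebra.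

Section FiniteSumsOfSeries.
Variables (R : realType) (I : choiceType) (D : set I) (J : Type).

Lemma bounded_sums_sum (r : seq J) (a : J -> I -> R) :
  (forall q, bounded_sums D (a q)) ->
  bounded_sums D (fun k => \sum_(q <- r) a q k).
Proof.
move=> ba; elim: r => [|q r IH].
  by exists 0 => A; rewrite big1// => i _; rewrite big_nil normr0.
by under eq_fun do rewrite big_cons; exact: bounded_sumsD.
Qed.

Lemma usum_sum (r : seq J) (a : J -> I -> R) :
  (forall q, bounded_sums D (a q)) ->
  usum D (fun k => \sum_(q <- r) a q k) = \sum_(q <- r) usum D (a q).
Proof.
move=> ba; elim: r => [|q r IH].
  have b0 : bounded_sums D (fun=> 0 : R) by exists 0 => A; rewrite big1// normr0.
  have := usum_lin 0 0 b0 b0; rewrite !mul0r addr0 => u0.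
  by under eq_fun do rewrite big_nil; rewrite big_nil -[RHS]u0; congr usum;
    apply/funext => k; rewrite !mul0r addr0.
rewrite big_cons -IH -[in RHS](mul1r (usum D (a q))) -[X in _ = _ + X]mul1r.
rewrite -usum_lin//; last exact: bounded_sums_sum.
by congr usum; apply/funext => k; rewrite big_cons !mul1r.
Qed.

End FiniteSumsOfSeries.

(** * Vector series through real coordinates *)

Section RealScaling.
Variable R : realType.
Local Open Scope complex_scope.
Let C : numFieldType := R[i].

Lemma cvg_real_complex T (F : set_system T) (FF : Filter F) (r : T -> R) (l : R) :
  r @ F --> l -> (fun s => (r s)%:C : C) @ F --> (l%:C : C).
Proof.
move=> /cvgrPdist_lt rl; apply/cvgrPdist_lt => -[e e'] /=.
rewrite ltcE /= => /andP[/eqP -> e0].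
have := rl e e0; apply: filterS => s; rewrite -rmorphB normc_def /= expr0n /= addr0.
by rewrite sqrtr_sqr ltcR.
Qed.

Lemma cvg_real_scale T (F : set_system T) (FF : Filter F) (r : T -> R) (l : R)
    (V : normedModType R[i]) (v : V) :
  r @ F --> l -> (r s)%:C *: v @[s --> F] --> l%:C *: v.
Proof. by move=> rl; apply: cvgZr_tmp; exact: cvg_real_complex. Qed.

End RealScaling.

Section CoordinateSeries.
Variables (R : realType) (n : nat).
Let V : normedModType R[i] := 'cV[R[i]]_n.
Local Open Scope complex_scope.

(** Real coordinates of a complex vector: [(i, true)] and [(i, false)] index the
    real and the imaginary part of the [i]-th entry. *)
Definition coord (j : 'I_n * bool) (v : V) : R :=
  if j.2 then complex.Re (v j.1 0) else complex.Im (v j.1 0).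

Definition cbasis (j : 'I_n * bool) : V :=
  (if j.2 then 1 else 0 +i* 1) *: delta_mx j.1 0.

Lemma coord_sum v : v = \sum_j (coord j v)%:C *: cbasis j.
Proof.
rewrite -(pair_bigA _ (fun i b => (coord (i, b) v)%:C *: cbasis (i, b))) /=.
rewrite [LHS]matrix_sum_delta; apply: eq_bigr => i _.
rewrite big_ord1 big_bool /cbasis /coord /= !scalerA -scalerDl.
congr (_ *: _); case: (v i 0) => x y; apply/eqP; rewrite eq_complex /=.
by rewrite !(mulr0, mul0r, mulr1, add0r, addr0, subr0) !eqxx.
Qed.

Lemma coordD j u v : coord j (u + v) = coord j u + coord j v.
Proof.
rewrite /coord !mxE; case: (u _ _) => a b; case: (v _ _) => c d.
by case: ifP.
Qed.

Lemma coord0 j : coord j 0 = 0.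
Proof. by rewrite /coord !mxE; case: ifP. Qed.

Lemma coordZ j (r : R) v : coord j (r%:C *: v) = r * coord j v.
Proof.
rewrite /coord !mxE; case: (v _ _) => a b.
by case: ifP => _ /=; rewrite !mul0r ?subr0 ?addr0.
Qed.

Lemma coord_le j v : `|coord j v| <= \sum_(i < n) Normc.normc (v i 0).
Proof.
apply: (@le_trans _ _ (Normc.normc (v j.1 0))).
  rewrite /coord; case: (v _ _) => a b /=.
  by case: ifP => _; rewrite -sqrtr_sqr; apply: ler_wsqrtr; rewrite ?lerDl ?lerDr sqr_ge0.
rewrite (bigD1 j.1)//= lerDl; apply: sumr_ge0 => i _.
by case: (v i 0) => a b; exact: sqrtr_ge0.
Qed.

Variables (I : choiceType) (D : set I).

(** Summability of vectors is decided on their real coordinates, which reduces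
    every limit to a limit in the complete field of reals. *)
Lemma coord_usum (F : I -> V) :
  (forall j, bounded_sums D (fun k => coord j (F k))) ->
  partial_sum D F @ @finsets I -->
  \sum_j (usum D (fun k => coord j (F k)))%:C *: cbasis j.
Proof.
move=> bF; have -> : partial_sum D F = (fun A =>
    \sum_j (partial_sum D (fun k => coord j (F k)) A)%:C *: cbasis j).
  apply/funext => A; rewrite [LHS]coord_sum; apply: eq_bigr => j _.
  congr (_%:C *: _); rewrite /partial_sum.
  by elim/big_rec2: _ => [|i x y _ <-]; [exact: coord0 | exact: coordD].
elim: (index_enum _) => [|j r IH].
  by rewrite big_nil; under eq_fun do rewrite big_nil; exact: cvg_cst.
rewrite big_cons; under eq_fun do rewrite big_cons.
by apply: cvgD IH; apply: cvg_real_scale; exact: bounded_sums_cvg.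
Qed.

End CoordinateSeries.

(** * Regularity of trigonometric series *)

Section TrigonometricSeries.
Variable R : realType.
Local Open Scope complex_scope.

Lemma derive_quotient (u : R -> R) (t du : R) : is_derive t 1 u du ->
  (s - t)^-1 * (u s - u t) @[s --> t^'] --> du.
Proof.
move=> [dt <-]; have /cvgrPdist_lt h := dt; apply/cvgrPdist_lt => e e0.
have /nbhs_ballP[r /= r0 hr] := h e e0.
apply/nbhs_ballP; exists r => //= s ts /= st.
have := hr (s - t); rewrite /ball /= sub0r normrN.
have ts' : `|s - t| < r by rewrite distrC; exact: ts.
move=> /(_ ts'); rewrite subr_eq0 => /(_ st).
by rewrite /GRing.scale /= mulr1 subrK.
Qed.

(** Indexing by a boolean lets differentiation exchange the two families within a
    single induction. *)
Definition trig (b : bool) (x : R) : R := if b then cos x else sin x.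

Lemma trig_derive b (x : R) :
  is_derive x 1 (trig b) ((-1) ^+ b * trig (~~ b) x).
Proof.
case: b => /=; first by rewrite mulN1r; exact: is_derive_cos.
by rewrite mul1r; exact: is_derive_sin.
Qed.

Lemma trig_le1 b x : `|trig b x| <= 1.
Proof.
rewrite ler_norml; case: b => /=; first by rewrite cos_geN1 cos_le1.
by rewrite sin_geN1 sin_le1.
Qed.

Lemma trig_scale_derive b (w t : R) :
  is_derive t 1 (fun s => trig b (w * s)) ((-1) ^+ b * w * trig (~~ b) (w * t)).
Proof.
have h : is_derive t 1 (fun s : R => w * s) (w * 1).
  by apply: is_derive_scal; exact: is_derive_id1.
have := is_derive1_comp (trig_derive b (w * t)) h.
by move/is_derive_eq; apply; rewrite mulr1 mulrAC.
Qed.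

Lemma trig_lipschitz b (w s t : R) :
  `|trig b (w * s) - trig b (w * t)| <= `|w| * `|s - t|.
Proof.
wlog st : s t / t <= s.
  by move=> h; have [/h//|/ltW/h] := leP t s; rewrite distrC [X in _ -> _ <= _ * X]distrC.
have [||c _ ->] := @MVT_segment R (fun s => trig b (w * s))
    (fun s => (-1) ^+ b * w * trig (~~ b) (w * s)) _ _ st.
- by move=> y _; exact: trig_scale_derive.
- apply: continuous_subspaceT => y.
  by apply: is_derive_cts; exact: trig_scale_derive.
rewrite !normrM normrX normrN1 expr1n mul1r ler_wpM2r// ler_piMr//.
exact: trig_le1.
Qed.

Variables (I : choiceType) (D : set I) (w : I -> R).
Implicit Types (al : I -> R).

Definition trig_series b al (t : R) : R := usum D (fun k => al k * trig b (w k * t)).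

Lemma trig_series_bounded b al t : bounded_sums D al ->
  bounded_sums D (fun k => al k * trig b (w k * t)).
Proof.
move=> /bounded_sums_norm; apply: bounded_sums_le => k _.
by rewrite normrM ler_piMr// trig_le1.
Qed.

Lemma trig_series_cts b al : bounded_sums D al -> continuous (trig_series b al).
Proof.
move=> bal t; apply: (@dominated_usum _ _ D _ (nbhs t) _
    (fun s k => al k * trig b (w k * s)) _ _ (bounded_sums_norm bal)) => [s k _|k _|k _].
- by rewrite normrM ler_piMr// trig_le1.
- by rewrite normrM ler_piMr// trig_le1.
apply: cvgMr; exact: (is_derive_cts (trig_scale_derive b (w k) t)).
Qed.

(** By the mean value theorem the difference quotients of [trig b (w k * _)] are
    bounded by [|w k|], so that dominated convergence differentiates the series
    term by term. *)
Lemma trig_series_quotient b al (P : set R) (t : R) :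
  bounded_sums D al -> bounded_sums D (fun k => al k * w k) ->
  (s - t)^-1 * (trig_series b al s - trig_series b al t)
    @[s --> within P t^'] --> trig_series (~~ b) (fun k => (-1) ^+ b * (al k * w k)) t.
Proof.
move=> bal balw.
have quotE s : (s - t)^-1 * (trig_series b al s - trig_series b al t) = usum D (fun k =>
    (s - t)^-1 * (al k * trig b (w k * s)) + (- (s - t)^-1) * (al k * trig b (w k * t))).
  rewrite usum_lin; [|exact: trig_series_bounded..].
  by rewrite mulNr mulrBr.
under eq_fun do rewrite quotE.
apply: (@dominated_usum _ _ D _ (within P t^') _
  (fun s k => (s - t)^-1 * (al k * trig b (w k * s))
              + (- (s - t)^-1) * (al k * trig b (w k * t)))
  _ _ (bounded_sums_norm balw)) => [s k _|k _|k _].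
- rewrite (_ : _ + _ = al k * ((s - t)^-1 *
    (trig b (w k * s) - trig b (w k * t)))); last by ring.
  rewrite !normrM ler_wpM2l// normfV; have [->|st] := eqVneq s t.
    by rewrite subrr normr0 invr0 mul0r.
  rewrite mulrC ler_pdivrMr ?normr_gt0 ?subr_eq0//.
  exact: trig_lipschitz.
- rewrite !normrM normrX normrN1 expr1n mul1r ler_piMr ?mulr_ge0//.
  exact: trig_le1.
apply: cvg_within_filter.
have -> : (-1) ^+ b * (al k * w k) * trig (~~ b) (w k * t)
  = al k * ((-1) ^+ b * w k * trig (~~ b) (w k * t)) by ring.
have -> : (fun s => (s - t)^-1 * (al k * trig b (w k * s))
                    + (- (s - t)^-1) * (al k * trig b (w k * t)))
  = (fun s => al k * ((s - t)^-1 * (trig b (w k * s) - trig b (w k * t)))).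
  by apply/funext => s; ring.
apply: cvgMr; exact: (derive_quotient (trig_scale_derive b (w k) t)).
Qed.

Lemma bounded_sums_lower_power (c0 : R) al p j : 0 < c0 ->
  (forall k, k \in D -> c0 <= w k) -> (j <= p)%N ->
  bounded_sums D (fun k => al k * w k ^+ p) ->
  bounded_sums D (fun k => al k * w k ^+ j).
Proof.
move=> c00 wc jp /bounded_sums_norm/(bounded_sumsZ (c0 ^- (p - j))).
apply: bounded_sums_le => k kD; have wk := wc k kD.
have wk0 : 0 < w k := lt_le_trans c00 wk.
have -> : al k * w k ^+ p = al k * w k ^+ j * w k ^+ (p - j).
  by rewrite -mulrA -exprD subnKC.
rewrite [X in _ <= _ * X]normrM mulrCA; apply: ler_peMr => //.
rewrite ler_pdivlMl ?exprn_gt0// mulr1 normrX (gtr0_norm wk0).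
by apply: lerXn2r; rewrite ?nnegrE ?(ltW c00) ?(ltW wk0).
Qed.

Variable V : normedModType R[i].

(** By induction on [p]: each derivative multiplies the amplitudes by the
    frequencies, and a positive lower bound on the frequencies makes the single
    condition on [al k * w k ^ p] control all the smaller powers. *)
Lemma Cp_trig_series (c0 : R) p b al (e : V) : 0 < c0 ->
  (forall k, k \in D -> c0 <= w k) ->
  bounded_sums D (fun k => al k * w k ^+ p) ->
  Cp_halfline p (fun t => (trig_series b al t)%:C *: e).
Proof.
move=> c00 wc; elim: p => [|p IH] in b al * => balp.
  have bal : bounded_sums D al.
    move: balp; rewrite (_ : (fun k => _) = al)//.
    by apply/funext => k; rewrite expr0 mulr1.
  apply: continuous_subspaceT => t; apply: cvg_real_scale.
  exact: trig_series_cts.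
have bal : bounded_sums D al.
  have := bounded_sums_lower_power c00 wc (leq0n _) balp.
  by rewrite (_ : (fun k => _) = al)//; apply/funext => k; rewrite expr0 mulr1.
have balw : bounded_sums D (fun k => al k * w k).
  exact: (bounded_sums_lower_power c00 wc (ltn0Sn _) balp).
exists (fun t => (trig_series (~~ b) (fun k => (-1) ^+ b * (al k * w k)) t)%:C *: e).
  move=> t _; under eq_fun => s do rewrite -scalerBl scalerA -rmorphB -rmorphM.
  by apply: cvg_real_scale; exact: trig_series_quotient.
apply: IH; have := bounded_sumsZ ((-1) ^+ b) balp.
rewrite (_ : (fun k => _) = (fun k => (-1) ^+ b * (al k * w k) * w k ^+ p))//.
by apply/funext => k; rewrite exprS !mulrA.
Qed.

End TrigonometricSeries.

Section CpClosure.
Variables (R : realType) (V : normedModType R[i]).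
Local Open Scope complex_scope.
Implicit Types (h : R -> V) (v : V).

Lemma Cp_add p h1 h2 : Cp_halfline p h1 -> Cp_halfline p h2 ->
  Cp_halfline p (fun t => h1 t + h2 t).
Proof.
elim: p h1 h2 => [|p IH] h1 h2 /=.
  by move=> c1 c2 t; apply: cvgD; [exact: c1 | exact: c2].
move=> [d1 hd1 cd1] [d2 hd2 cd2]; exists (fun t => d1 t + d2 t); last exact: IH.
move=> t t0; under eq_fun do rewrite opprD addrACA scalerDr.
by apply: cvgD; [exact: hd1 | exact: hd2].
Qed.

Lemma Cp_cst p v : Cp_halfline p (fun _ : R => v).
Proof.
elim: p v => [|p IH] v /=; first by apply: continuous_subspaceT => t; exact: cvg_cst.
exists (fun=> 0); last exact: IH.
by move=> t _; under eq_fun do rewrite subrr scaler0; exact: cvg_cst.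
Qed.

Lemma Cp_linear p v : Cp_halfline p (fun t : R => t%:C *: v).
Proof.
case: p => [|p] /=.
  by apply: continuous_subspaceT => t; apply: cvg_real_scale; exact: cvg_id.
exists (fun=> v); last exact: Cp_cst.
move=> t _; apply: cvg_within_filter.
have : (s - t)^-1 * (s - t) @[s --> t^'] --> (1 : R).
  exact: (derive_quotient (is_derive_id1 t)).
move=> /(@cvg_real_scale R _ _ _ _ _ V v); rewrite scale1r.
by under eq_fun do rewrite rmorphM -scalerA rmorphB scalerBl.
Qed.

Lemma Cp_sum p (J : finType) (h : J -> R -> V) :
  (forall j, Cp_halfline p (h j)) -> Cp_halfline p (fun t => \sum_j h j t).
Proof.
move=> ch; elim: (index_enum _) => [|j r IH].
  by under eq_fun do rewrite big_nil; exact: Cp_cst.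
by under eq_fun do rewrite big_cons; exact: Cp_add.
Qed.

End CpClosure.

(** * Spectral projections and Sobolev coefficients *)

Section SpectralProjections.
Variables (R : realType) (n : nat).
Implicit Types (v : 'cV[R]_n).

Definition lineproj v : 'M[R]_n := (sqnorm v)^-1 *: (v *m v^T).
(** The spectral projections of every matrix [eigmx a b v]: [true] selects the
    line of [v], [false] its orthogonal complement. *)
Definition specproj (b : bool) v : 'M[R]_n :=
  if b then lineproj v else 1%:M - lineproj v.

Lemma eigmx_spec (a b : R) v :
  eigmx a b v = a *: specproj true v + b *: specproj false v.
Proof.
rewrite /eigmx /specproj /lineproj scalerBr scalemx1 addrCA.
by congr (_ + _); rewrite !scalerA -scalerBl mulrBl.
Qed.

Lemma lineproj_idem v : v != 0 -> lineproj v *m lineproj v = lineproj v.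
Proof.
move=> v0; rewrite /lineproj -scalemxAl -scalemxAr scalerA.
have -> : v *m v^T *m (v *m v^T) = sqnorm v *: (v *m v^T).
  rewrite mulmxA -[v *m v^T *m v]mulmxA.
  have -> : v^T *m v = (sqnorm v)%:M.
    apply/matrixP => i j; rewrite !ord1 !mxE eqxx mulr1n.
    by apply: eq_bigr => l _; rewrite mxE expr2.
  by rewrite mul_mx_scalar -scalemxAl.
by rewrite scalerA mulfVK ?sqnorm_eq0.
Qed.

Lemma specproj_mul v b c : v != 0 ->
  specproj b v *m specproj c v = if b == c then specproj b v else 0.
Proof.
move=> v0; have PP := lineproj_idem v0.
by case: b; case: c; rewrite /= /specproj
  ?mulmxBl ?mulmxBr ?mul1mx ?mulmx1 PP ?subrr ?subr0.
Qed.

Lemma eigmx_mul (a b a' b' : R) v : v != 0 ->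
  eigmx a b v *m eigmx a' b' v = eigmx (a * a') (b * b') v.
Proof.
move=> v0; rewrite !eigmx_spec /=; have pm b1 b2 := specproj_mul b1 b2 v0.
move: (pm true true) (pm true false) (pm false true) (pm false false) => /=.
move: (lineproj v) (1%:M - lineproj v) => P Q PP PQ QP QQ.
rewrite mulmxDl !mulmxDr -!scalemxAl -!scalemxAr PP PQ QP QQ.
by rewrite !scaler0 addr0 add0r !scalerA.
Qed.

Lemma eigmx_invmx (a b : R) v : v != 0 -> a != 0 -> b != 0 ->
  invmx (eigmx a b v) = eigmx a^-1 b^-1 v.
Proof.
move=> v0 a0 b0; have AB : eigmx a b v *m eigmx a^-1 b^-1 v = 1%:M.
  by rewrite eigmx_mul// !divff// eigmx_spec !scale1r /specproj addrC subrK.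
have [ua _] := mulmx1_unit AB.
by rewrite -[LHS]mulmx1 -AB mulKmx.
Qed.

Lemma specproj_le2 b v i j : v != 0 -> `|specproj b v i j| <= 2.
Proof.
move=> v0.
have N0 : 0 < sqnorm v.
  by rewrite lt_def sqnorm_eq0 v0 sumr_ge0// => l _; exact: sqr_ge0.
have sq_le l : v l 0 ^+ 2 <= sqnorm v.
  by rewrite /sqnorm (bigD1 l)//= lerDl sumr_ge0// => m _; exact: sqr_ge0.
have P1 : `|lineproj v i j| <= 1.
  rewrite /lineproj !mxE big_ord1 mxE normrM normfV (gtr0_norm N0).
  rewrite mulrC ler_pdivrMr// mul1r normrM.
  have := sq_le i; have := sq_le j.
  rewrite -(real_normK (num_real (v i 0))) -(real_normK (num_real (v j 0))).
  by nra.
case: b => /=; first by apply: le_trans P1 _; rewrite ler1n.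
rewrite mxE; apply: le_trans (ler_normD _ _) _.
rewrite [X in X <= _](_ : _ = `|(1%:M : 'M[R]_n) i j| + `|lineproj v i j|); last first.
  by rewrite !mxE normrN.
rewrite (_ : 2 = 1 + 1)//; apply: lerD => //.
by rewrite mxE; case: (i == j); rewrite ?normr1 ?normr0.
Qed.

End SpectralProjections.

Section VectorBounds.
Variables (R : realType) (n : nat).
Local Notation V := 'cV[R[i]]_n.
Local Open Scope complex_scope.

Definition norm1 (z : V) : R := \sum_(i < n) Normc.normc (z i 0).

Lemma normc_ge0 (z : R[i]) : 0 <= Normc.normc z.
Proof. by case: z => a b; exact: sqrtr_ge0. Qed.

Lemma norm1_ge0 z : 0 <= norm1 z.
Proof. by apply: sumr_ge0 => i _; exact: normc_ge0. Qed.

Lemma normc_real (r : R) : Normc.normc r%:C = `|r|.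
Proof. by rewrite /= expr0n addr0 sqrtr_sqr. Qed.

Lemma normc_expi (th : R) : Normc.normc (expi th) = 1.
Proof. by rewrite /= cos2Dsin2 sqrtr1. Qed.

Lemma normc_sum (J : Type) (r : seq J) (F : J -> R[i]) :
  Normc.normc (\sum_(j <- r) F j) <= \sum_(j <- r) Normc.normc (F j).
Proof.
elim/big_rec2: _ => [|j y x _ h]; first by rewrite Normc.normc0.
by apply: le_trans (le_normcD _ _) _; rewrite lerD2l.
Qed.

Lemma coord_phase_proj_le (j : 'I_n * bool) (th : R) b (v : 'cV[R]_n) (z : V) :
  v != 0 ->
  `|coord j (expi th *: (cmx (specproj b v) *m z))| <= (2 * n%:R) * norm1 z.
Proof.
move=> v0; apply: le_trans (coord_le _ _) _.
apply: (@le_trans _ _ (\sum_(i < n) 2 * norm1 z)); last first.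
  by rewrite sumr_const card_ord -[leLHS]mulr_natl mulrCA mulrA.
apply: ler_sum => i _; rewrite mxE Normc.normcM normc_expi mul1r mxE.
apply: le_trans (normc_sum _ _) _; rewrite mulr_sumr; apply: ler_sum => l _.
rewrite Normc.normcM ler_wpM2r ?normc_ge0// mxE normc_real.
exact: specproj_le2.
Qed.

Lemma zvec_sqnorm_ge1 (k : 'cV[int]_n) : k != 0 -> 1 <= sqnorm (zvec R k).
Proof.
rewrite -(zvec_eq0 R) -sqnorm_eq0.
have -> : sqnorm (zvec R k) = (\sum_(i < n) k i 0 ^+ 2)%:~R.
  by rewrite /sqnorm rmorph_sum; apply: eq_bigr => i _; rewrite mxE rmorphXn.
rewrite intr_eq0 => s0; rewrite -[1]/(1%:~R) ler_int -gtz0_ge1 lt_def s0.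
by apply: sumr_ge0 => i _; exact: sqr_ge0.
Qed.

Lemma Hspace_bounded (s : R) (f : 'cV[int]_n -> V) : Hspace s f ->
  exists S : R, forall A : {fset 'cV[int]_n},
    \sum_(k <- A) (1 + sqnorm (zvec R k)) `^ s * csqnorm (f k) <= S.
Proof.
rewrite /Hspace /=; set T := esum _ _ => Tfin.
have T0 : (0 <= T)%E.
  apply: esum_ge0 => k _; rewrite lee_fin mulr_ge0 ?powR_ge0//.
  by apply: sumr_ge0 => i _; exact: sqr_ge0.
exists (fine T) => A; rewrite -lee_fin fineK ?ge0_fin_numE//.
apply: esum_ge; exists [set` A]; first by split=> //; exact: finite_fset.
by rewrite fsbig_finite//= set_fsetK sumEFin.
Qed.

(** Young's inequality separates the coefficients, which the Sobolev norm sums,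
    from the weight, of which [n%:R + r <= s] leaves [(1 + |k| ^ 2) ^ (- n)] to be
    summed over the lattice. *)
Lemma Hspace_weighted (s r K : R) (f : 'cV[int]_n -> V) (W : 'cV[int]_n -> R) :
  Hspace s f -> n%:R + r <= s -> 0 <= K ->
  (forall k, k != 0 -> W k ^+ 2 <= K * (1 + sqnorm (zvec R k)) `^ r) ->
  bounded_sums [set k | k != 0] (fun k => norm1 (f k) * W k).
Proof.
move=> /Hspace_bounded[S hS] hs K0 hW.
have [T hT] := lattice_sum_bounded R n.
exists (S + n%:R * K * T) => A.
apply: le_trans (lerD (hS A) (ler_wpM2l (mulr_ge0 (ler0n _ n) K0) (hT A))).
rewrite mulr_sumr -big_split /= big_mkcond /=; apply: ler_sum => k _.
set N := 1 + sqnorm (zvec R k).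
have N1 : 1 <= N by rewrite lerDl sumr_ge0// => i _; exact: sqr_ge0.
have N0 : 0 < N := lt_le_trans ltr01 N1.
have c0 : 0 <= csqnorm (f k) by apply: sumr_ge0 => i _; exact: sqr_ge0.
case: ifPn => [|_]; last by rewrite addr_ge0 ?mulr_ge0 ?powR_ge0.
rewrite inE /= => k0; rewrite normrM ger0_norm ?norm1_ge0//.
have W2 : W k ^+ 2 * N `^ (- s) <= K * N `^ (- n%:R).
  apply: le_trans (ler_wpM2r (powR_ge0 _ _) (hW k k0)) _.
  rewrite -mulrA -powRD ?(gt_eqF N0) ?implybT// ler_wpM2l//.
  by apply: ler_powR => //; lra.
have Ns : N `^ s * N `^ (- s) = 1.
  by rewrite -powRD ?(gt_eqF N0) ?implybT// subrr powRr0.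
apply: (@le_trans _ _ (\sum_(i < n)
    (N `^ s * Normc.normc (f k i 0) ^+ 2 + K * N `^ (- n%:R)))).
  rewrite /norm1 mulr_suml; apply: ler_sum => i _.
  apply: le_trans (lerD (lexx _) W2).
  have := normc_ge0 (f k i 0); have := normr_ge0 (W k).
  have := powR_gt0 s N0; have := powR_gt0 (- s) N0.
  rewrite -(real_normK (num_real (W k))).
  move: Ns; move: (N `^ s) (N `^ (- s)) (Normc.normc _) `|W k| => p q x y pq q0 p0 y0 x0.
  (* [p x ^ 2 + q y ^ 2 - 2 x y = q (p x - y) ^ 2], as [p q = 1] *)
  have : 0 <= q * (p * x - y) ^+ 2 by rewrite mulr_ge0 ?sqr_ge0// ltW.
  have -> : q * (p * x - y) ^+ 2
      = (p * q) * (p * x ^+ 2) - 2 * (p * q) * (x * y) + q * y ^+ 2.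
    by ring.
  rewrite pq; have : 0 <= x * y by rewrite mulr_ge0.
  by lra.
rewrite big_split /= -mulr_sumr lerD2l sumr_const card_ord -[leLHS]mulr_natl.
by rewrite mulrA.
Qed.

End VectorBounds.

(** * The solution *)

Section SolutionSeries.
Variables (R : realType) (n : nat) (delta beta mu lams : R).
Hypotheses (n0 : (0 < n)%N) (delta0 : 0 < delta).
Hypothesis hbeta : n%:R < beta < n%:R + 2.
Hypothesis mu0 : 0 < mu.
Hypothesis lambda1_lt0 : forall nu : 'cV[R]_n,
  nu != 0 -> lambda1 delta beta mu lams nu < 0.
Hypothesis lambda2_lt0 : forall nu : 'cV[R]_n,
  nu != 0 -> lambda2 delta beta mu nu < 0.
Variables (f g : 'cV[int]_n -> 'cV[R[i]]_n).
Local Open Scope complex_scope.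
Let V : normedModType R[i] := 'cV[R[i]]_n.

Let D : set 'cV[int]_n := [set k | k != 0].
Let eta : R := (beta - n%:R) / 2.
Let N (k : 'cV[int]_n) : R := 1 + sqnorm (zvec R k).

(** [true] stands for the direction of [k], [false] for its orthogonal
    complement. *)
Definition freq (b : bool) (k : 'cV[int]_n) : R :=
  Num.sqrt (- (if b then lambda1 delta beta mu lams (zvec R k)
               else lambda2 delta beta mu (zvec R k))).

Lemma freq_gt0 b k : k != 0 -> 0 < freq b k.
Proof.
move=> k0; rewrite sqrtr_gt0 oppr_gt0.
by case: b; rewrite ?lambda1_lt0 ?lambda2_lt0// zvec_eq0.
Qed.

Lemma freq_growth b : exists m M : R, [/\ 0 < m, 0 < M & forall k, k != 0 ->
  m * N k `^ eta <= freq b k ^+ 2 <= M * N k `^ eta].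
Proof.
have [m [M [m0 M0 h]]] : exists m M : R, [/\ 0 < m, 0 < M &
    forall nu : 'cV[R]_n, 1 <= sqnorm nu ->
    m * (1 + sqnorm nu) `^ eta
    <= - (if b then lambda1 delta beta mu lams nu else lambda2 delta beta mu nu)
    <= M * (1 + sqnorm nu) `^ eta].
  case: b; first exact: lambda1_growth.
  exact: lambda2_growth.
exists m, M; split=> // k k0; have := freq_gt0 b k0; rewrite sqrtr_gt0 => /ltW l0.
by rewrite sqr_sqrtr//; apply: h; exact: zvec_sqnorm_ge1.
Qed.

(** The amplitude of the oscillation [trig c (freq b k * t)] in the [k]-th term:
    cosines carry the initial position, sines the initial velocity. *)
Definition amplitude (x : 'cV[R]_n) (q : bool * bool) (k : 'cV[int]_n) : 'cV[R[i]]_n :=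
  let A z := expi (dotv (zvec R k) x) *: (cmx (specproj q.2 (zvec R k)) *m z) in
  if q.1 then A (f k) else (freq q.2 k)^-1%:C *: A (g k).

Lemma cmx_lin (a b : R) (P Q : 'M[R]_n) (z : 'cV[R[i]]_n) :
  cmx (a *: P + b *: Q) *m z = a%:C *: (cmx P *m z) + b%:C *: (cmx Q *m z).
Proof. by rewrite /cmx map_mxD !map_mxZ mulmxDl -!scalemxAl. Qed.

Lemma cmx_linM (a a' b b' : R) (P Q : 'M[R]_n) (z : 'cV[R[i]]_n) :
  cmx ((a * a') *: P + (b * b') *: Q) *m z
  = a%:C *: (a'%:C *: (cmx P *m z)) + b%:C *: (b'%:C *: (cmx Q *m z)).
Proof. by rewrite cmx_lin !(rmorphM (real_complex R)) -!scalerA. Qed.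

Lemma scale_swap (W : lmodType R[i]) (e c : R[i]) (X : W) :
  e *: (c *: X) = c *: (e *: X).
Proof. by rewrite !scalerA mulrC. Qed.

Lemma sum_bool2 (W : nmodType) (F : bool * bool -> W) :
  \sum_q F q = F (true, true) + F (true, false) + (F (false, true) + F (false, false)).
Proof.
rewrite (eq_bigr (fun q => F (q.1, q.2))) => [|[] //].
by rewrite -(pair_bigA _ (fun c b => F (c, b))) !big_bool.
Qed.

Lemma solution_termE x t k : k != 0 ->
  solution_term delta beta mu lams f g x t k
  = \sum_q (trig q.1 (freq q.2 k * t))%:C *: amplitude x q k.
Proof.
move=> k0; have v0 : zvec R k != 0 by rewrite zvec_eq0.
have [w1 w2] := (freq_gt0 true k0, freq_gt0 false k0).
have cosE : cos_sqrtNM delta beta mu lams t k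
    = trig true (freq true k * t) *: specproj true (zvec R k)
      + trig true (freq false k * t) *: specproj false (zvec R k).
  exact: eigmx_spec.
have sinE : sin_sqrtNM delta beta mu lams t k *m invmx (sqrtNM delta beta mu lams k)
    = (trig false (freq true k * t) * (freq true k)^-1) *: specproj true (zvec R k)
      + (trig false (freq false k * t) * (freq false k)^-1) *: specproj false (zvec R k).
  rewrite /sin_sqrtNM /sqrtNM /multfun eigmx_invmx ?(gt_eqF w1) ?(gt_eqF w2)//.
  by rewrite eigmx_mul// eigmx_spec.
rewrite /solution_term cosE sinE sum_bool2 cmx_lin cmx_linM /amplitude.
cbn [fst snd].
move: (cmx _ *m f k) (cmx _ *m f k) (cmx _ *m g k) (cmx _ *m g k) => X1 X2 Y1 Y2.
move: (trig true _)%:C (trig true _)%:C => c1 c2.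
move: (trig false _)%:C (trig false _)%:C => d1 d2.
move: (_^-1)%:C (_^-1)%:C (expi _) => w1' w2' e.
rewrite !scalerDr.
by rewrite (scale_swap e c1) (scale_swap e c2) (scale_swap e d1) (scale_swap e d2)
  (scale_swap e w1') (scale_swap e w2').
Qed.

Variables (s1 s2 : R) (p : nat).
Hypotheses (hf : Hspace s1 f) (hg : Hspace s2 g).
Hypothesis hps1 : n%:R + p%:R * eta < s1.
Hypothesis hps2 : n%:R + (p%:R - 1) * eta < s2.

Lemma freq_pow_le b : exists2 M, 0 <= M & forall k, k != 0 ->
  (freq b k ^+ p) ^+ 2 <= M * N k `^ (p%:R * eta).
Proof.
have [m [M [m0 M0 h]]] := freq_growth b; exists (M ^+ p) => [|k k0].
  by rewrite exprn_ge0// ltW.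
have /andP[_ hM] := h k k0.
have -> : N k `^ (p%:R * eta) = (N k `^ eta) ^+ p.
  by rewrite mulrC powRrM powR_mulrn ?powR_ge0.
rewrite exprAC -exprMn; apply: lerXn2r; rewrite ?nnegrE ?sqr_ge0//.
by rewrite mulr_ge0 ?powR_ge0// ltW.
Qed.

(** The weights to be summed are [freq ^ p] for the positions and
    [freq ^ (p - 1)] for the velocities; their squares are of order at most
    [p * eta] and [(p - 1) * eta] in [N]; dividing by the frequency uses its lower
    bound, without which the second order would fail for [p = 0]. *)
Lemma amplitude_bounded x (j : 'I_n * bool) q :
  bounded_sums D (fun k => coord j (amplitude x q k) * freq q.2 k ^+ p).
Proof.
case: q => c b /=.
have [M M0 hM] := freq_pow_le b.
have [m [M' [m0 _ hm]]] := freq_growth b.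
have N0 k : 0 < N k by rewrite ltr_wpDr// sumr_ge0// => i _; exact: sqr_ge0.
case: c => /=.
  have := Hspace_weighted hf (ltW hps1) M0 hM.
  move=> /(bounded_sumsZ (2 * n%:R)); apply: bounded_sums_le => k.
  rewrite inE /= => k0; have w0 := ltW (freq_gt0 b k0).
  rewrite mulrA normrM (ger0_norm (exprn_ge0 _ w0)) ler_wpM2r ?exprn_ge0//.
  by apply: coord_phase_proj_le; rewrite zvec_eq0.
pose W k := (freq b k)^-1 * freq b k ^+ p.
have hW k : k != 0 -> W k ^+ 2 <= (M / m) * N k `^ ((p%:R - 1) * eta).
  move=> k0; have w0 := freq_gt0 b k0; have /andP[hmk _] := hm k k0.
  rewrite /W exprMn exprVn mulrC ler_pdivrMr ?exprn_gt0//.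
  apply: le_trans (hM k k0) _.
  have -> : N k `^ (p%:R * eta) = N k `^ ((p%:R - 1) * eta) * N k `^ eta.
    by rewrite -powRD ?(gt_eqF (N0 k)) ?implybT//; congr (_ `^ _); ring.
  rewrite (_ : M / m * _ * _
    = M * (N k `^ ((p%:R - 1) * eta) * (freq b k ^+ 2 / m))); last by ring.
  rewrite ler_wpM2l// ler_wpM2l ?powR_ge0//.
  by rewrite ler_pdivlMr// mulrC.
have := Hspace_weighted hg (ltW hps2) (divr_ge0 M0 (ltW m0)) hW.
move=> /(bounded_sumsZ (2 * n%:R)); apply: bounded_sums_le => k.
rewrite inE /= => k0; have w0 := ltW (freq_gt0 b k0).
have W0 : 0 <= W k by rewrite mulr_ge0 ?exprn_ge0 ?invr_ge0.
rewrite /amplitude /= coordZ -[_^-1 * _ * _]mulrA mulrCA -/(W k).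
rewrite normrM (ger0_norm W0) mulrA ler_wpM2r//.
by apply: coord_phase_proj_le; rewrite zvec_eq0.
Qed.

Lemma freq_lower b : exists2 c0 : R, 0 < c0 & forall k, k \in D -> c0 <= freq b k.
Proof.
have [m [M' [m0 _ hm]]] := freq_growth b; exists (Num.sqrt m).
  by rewrite sqrtr_gt0.
move=> k; rewrite inE /= => k0; have /andP[hmk _] := hm k k0.
have w0 := ltW (freq_gt0 b k0).
rewrite -[leRHS](ger0_norm w0) -sqrtr_sqr; apply: ler_wsqrtr.
apply: le_trans hmk; apply: ler_peMr; first exact: ltW.
have N1 : 1 <= N k by rewrite lerDl sumr_ge0// => i _; exact: sqr_ge0.
have eta0 : 0 <= eta by case/andP: hbeta => h _; rewrite divr_ge0// subr_ge0 ltW.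
apply: le_trans (ge0_ler_powR eta0 _ _ N1); rewrite ?nnegrE ?powR1//.
exact: le_trans N1.
Qed.

Let S x j q t : R := trig_series D (freq q.2) q.1 (fun k => coord j (amplitude x q k)) t.

Lemma coord_amplitude_bounded x j q :
  bounded_sums D (fun k => coord j (amplitude x q k)).
Proof.
have [c0 c00 hc] := freq_lower q.2.
have := bounded_sums_lower_power c00 hc (leq0n p) (amplitude_bounded x j q).
by rewrite (_ : (fun k => _) = (fun k => coord j (amplitude x q k)))//;
  apply/funext => k; rewrite expr0 mulr1.
Qed.

Lemma coord_solution_term x t j k : k \in D ->
  coord j (solution_term delta beta mu lams f g x t k)
  = \sum_q coord j (amplitude x q k) * trig q.1 (freq q.2 k * t).
Proof.
rewrite inE /= => k0; rewrite solution_termE//.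
by elim/big_rec2: _ => [|q y u _ <-]; rewrite ?coord0// coordD coordZ mulrC.
Qed.

Lemma coord_solution_sum_bounded x t j : bounded_sums D (fun k =>
  \sum_q coord j (amplitude x q k) * trig q.1 (freq q.2 k * t)).
Proof.
apply: bounded_sums_sum => q; apply: trig_series_bounded.
exact: coord_amplitude_bounded.
Qed.

Lemma coord_solution_bounded x t j :
  bounded_sums D (fun k => coord j (solution_term delta beta mu lams f g x t k)).
Proof.
apply: eq_bounded_sums (coord_solution_sum_bounded x t j) => k kD.
exact: coord_solution_term.
Qed.

Lemma usum_coord_solution x t j :
  usum D (fun k => coord j (solution_term delta beta mu lams f g x t k))
  = \sum_q S x j q t.
Proof.
rewrite (eq_usum (fun k => @coord_solution_term x t j k)) usum_sum// => q.
by apply: trig_series_bounded; exact: coord_amplitude_bounded.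
Qed.

Lemma solution_term_cvg x t :
  partial_sum D (solution_term delta beta mu lams f g x t : _ -> V)
    @ @finsets 'cV[int]_n -->
  \sum_j (\sum_q S x j q t)%:C *: (cbasis R j : V).
Proof.
have -> : \sum_j (\sum_q S x j q t)%:C *: (cbasis R j : V) = \sum_j (usum D
    (fun k => coord j (solution_term delta beta mu lams f g x t k)))%:C
      *: (cbasis R j : V).
  by apply: eq_bigr => j _; rewrite usum_coord_solution.
exact: (@coord_usum R n _ D _ (coord_solution_bounded x t)).
Qed.

Lemma solution_usummable x t :
  usummable D (solution_term delta beta mu lams f g x t : _ -> V).
Proof. exact: cvgP _ (@solution_term_cvg x t). Qed.

Lemma solution_Cp x :
  Cp_halfline p (solution delta beta mu lams f g x : R -> V).
Proof.
have -> : solution delta beta mu lams f g x = (fun t : R => (f 0 + t%:C *: g 0)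
    + \sum_j \sum_q (S x j q t)%:C *: (cbasis R j : V)).
  apply/funext => t; rewrite /solution; congr (_ + _).
  have -> : usum D (solution_term delta beta mu lams f g x t : _ -> V)
      = \sum_j (\sum_q S x j q t)%:C *: (cbasis R j : V).
    exact: (cvg_lim (@norm_hausdorff _ V) (@solution_term_cvg x t)).
  by apply: eq_bigr => j _; rewrite rmorph_sum scaler_suml.
apply: (@Cp_add R V).
  by apply: (@Cp_add R V); [exact: Cp_cst | exact: Cp_linear].
apply: (@Cp_sum R V) => j; apply: (@Cp_sum R V) => q.
have [c0 c00 hc] := freq_lower q.2.
exact: Cp_trig_series c00 hc (amplitude_bounded x j q).
Qed.

End SolutionSeries.

Theorem theorem24 (R : realType) (n : nat) (delta beta mu lams : R)
    (hn : (1 <= n)%N) (hdelta : 0 < delta)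
    (hbeta : n%:R < beta < n%:R + 2)
    (hmu : 0 < mu)
    (hlambda1 : forall nu : 'cV[R]_n,
        nu != 0 -> lambda1 delta beta mu lams nu < 0)
    (hlambda2 : forall nu : 'cV[R]_n,
        nu != 0 -> lambda2 delta beta mu nu < 0)
    (s1 s2 : R) (hs1 : 0 <= s1) (hs2 : 0 <= s2)
    (f g : 'cV[int]_n -> 'cV[R[i]]_n)
    (hf : Hspace s1 f) (hg : Hspace s2 g)
    (p : nat)
    (hps1 : n%:R + p%:R * ((beta - n%:R) / 2) < s1)
    (hps2 : n%:R + (p%:R - 1) * ((beta - n%:R) / 2) < s2) :
  forall x : 'cV[R]_n, torus x ->
    (forall t : R, 0 <= t ->
       usummable [set k | k != 0] (solution_term delta beta mu lams f g x t)) /\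
    Cp_halfline p (solution delta beta mu lams f g x).
Proof.
move=> x _; split=> [t _|].
  exact: (solution_usummable hn hdelta hbeta hmu hlambda1 hlambda2 hf hg hps1 hps2).
exact: (solution_Cp hn hdelta hbeta hmu hlambda1 hlambda2 hf hg hps1 hps2).
Qed.
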